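(* Let $s,t\ge 2$ be integers. Then there exists $\ell_0$ such that for all $\ell\ge \ell_0$, $$\mathrm{ex}\big(n,D^{\ell}_{t-1,s-1}\big)=\Theta\big(n^{2-\frac{t}{st-1}}\big).$$
   Context: $\mathrm{ex}(n,F)$ is the maximum number of edges in an $n$-vertex graph with no subgraph isomorphic to $F$. For $s,t\in\mathbb N$, $D_{t,s}$ is the tree obtained from a star with $t$ edges by attaching $s$ new pendant leaves to each of its $t+1$ vertices, rooted on its leaves. For a rooted graph $(F,R)$ and $\ell\in\mathbb N$, the blow-up $F^\ell$ is obtained from $\ell$ vertex-disjoint copies of $F$ by identifying, for each root $v\in R$, the $\ell$ copies of $v$ into one vertex. *)

(* Defs.v *)
From mathcomp Require Import all_boot.
From Stdlib Require Import Reals.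
Set Implicit Arguments. Unset Strict Implicit. Unset Printing Implicit Defensive.

Definition simple_graph (n : nat) (g : {ffun 'I_n * 'I_n -> bool}) : bool :=
  [forall x, ~~ g (x, x)] && [forall x, forall y, g (x, y) == g (y, x)].

Definition nedges (n : nat) (g : {ffun 'I_n * 'I_n -> bool}) : nat :=
  #|[set p : 'I_n * 'I_n | g p && (p.1 < p.2)]|.

Definition contains (T : finType) (eF : rel T) (n : nat)
    (g : {ffun 'I_n * 'I_n -> bool}) : bool :=
  [exists f : {ffun T -> 'I_n},
     injectiveb f && [forall x, forall y, eF x y ==> g (f x, f y)]].

Definition ex (T : finType) (eF : rel T) (n : nat) : nat :=
  \max_(g : {ffun 'I_n * 'I_n -> bool} | simple_graph g && ~~ contains eF g)
     nedges g.

(* The tree D_{t,s}: a star with centre None and leaves Some i (i < t);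
   each of the t+1 star vertices u gets s pendant leaves (u, j), j < s. *)
Definition Dvert (t s : nat) : finType := (option 'I_t + (option 'I_t * 'I_s))%type.

Definition Dedge (t s : nat) : rel (Dvert t s) := fun x y =>
  match x, y with
  | inl None, inl (Some _) | inl (Some _), inl None => true
  | inl u, inr (v, _) | inr (v, _), inl u => u == v
  | _, _ => false
  end.

Definition leaves (T : finType) (e : rel T) : {set T} :=
  [set v | #|[set w | e v w]| == 1].

(* Blow-up F^l of a rooted graph (F, R): l disjoint copies (v, i), i < l, with the
   copies of each root identified (the root is represented by its copy with i = 0). *)
Definition blowup_vert (T : finType) (R : {set T}) (l : nat) : finType :=
  {p : T * 'I_l | (p.1 \in R) ==> (val p.2 == 0)}.

Definition blowup_edge (T : finType) (e : rel T) (R : {set T}) (l : nat)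
    : rel (blowup_vert R l) := fun x y =>
  e (val x).1 (val y).1 &&
  [|| (val x).2 == (val y).2, (val x).1 \in R | (val y).1 \in R].

Definition Dblow (t s l : nat) : rel (blowup_vert (leaves (@Dedge t s)) l) :=
  @blowup_edge _ (@Dedge t s) (leaves (@Dedge t s)) l.

(* Main.v *)
(** Write [s = r + 1] and [t = k + 1], so that the tree has [k + 1] inner vertices, [r] roots
    attached to each of them, and [b = (k + 1) r + k] edges.

    Upper bound.  Pass to a subgraph of minimum degree [d] and weight the copies of the tree by the
    tree-indexed stationary random walk; then every star of the tree has the same law, without any
    regularity assumption.  Call a star with [r + 1] leaves heavy if the weighted codegree of its
    leaves is at least a large constant.  If heavy stars are rare, a typical copy contains none; on
    some tuple of roots there are then many such copies while each vertex lies in few of them, and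
    disjoint copies are chosen greedily.  If heavy stars are not rare, convexity makes heavy sets
    positively dense inside the common neighbourhood [N] of some [r]-set, which serves as the roots
    of the centre: the other roots and the centres are chosen in [N], and the satellites greedily.

    Lower bound.  Join two copies of [F_q^b] by the common zeros of [k + 1] random polynomials of
    bounded degree.  For given roots, the copies of the tree solve as many equations as there are
    unknowns.  At most a constant number of solutions is nonsingular (Bezout), and each singular one
    costs an extra factor [1/q], since values and gradients of a random polynomial at boundedly many
    points are independent.  Hence a long list of disjoint singular copies on common roots has such
    a small probability that a union bound over the roots excludes it. *)

From HB Require Import structures.
From Stdlib Require Import Reals.
From mathcomp Require Import all_boot all_order all_algebra all_field.
From mathcomp Require Import ring lra zify.
Require Import Defs.
Set Implicit Arguments. Unset Strict Implicit. Unset Printing Implicit Defensive.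
Import Order.TTheory GRing.Theory Num.Theory.

Definition tree_size (k r : nat) : nat := k.+1 * r + k.

Definition neighbours (V : finType) (e : rel V) (x : V) : {set V} := [set y | e x y].

Definition blowup_embedding (V : finType) (e : rel V) (k r l : nat) : Prop :=
  exists (g : option 'I_k * 'I_r -> V) (X : 'I_l -> option 'I_k -> V),
    [/\ injective g,
        forall j u j' u', X j u = X j' u' -> j = j' /\ u = u',
        forall j u a, X j u <> g a,
        forall j u i, e (X j u) (g (u, i))
      & forall j i, e (X j None) (X j (Some i))].

Lemma leq_wexp2r (m n e : nat) : m <= n -> m ^ e <= n ^ e.
Proof. by move=> mn; case: e => // e; rewrite leq_exp2r. Qed.

(** * Finite sums *)

Lemma leq_card_imsetT (I V : finType) (f : I -> V) : #|f @: setT| <= #|I|.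
Proof. by rewrite (leq_trans (leq_imset_card _ _)) ?cardsT. Qed.

Lemma exchange_sum_card (S T : finType) (P : S -> T -> bool) :
  \sum_x #|[set y | P x y]| = \sum_y #|[set x | P x y]|.
Proof.
under eq_bigr do rewrite -sum1dep_card big_mkcond /=.
by rewrite exchange_big; apply: eq_bigr => y _; rewrite -big_mkcond sum1dep_card.
Qed.

(* A crude power mean inequality: half of the mass of [h] sits where [B <= 2 * Q * h x]. *)
Lemma sum_expn_ge (T : finType) (N : {set T}) (h : T -> nat) (B Q k : nat) :
  0 < Q -> (forall x, x \in N -> h x <= B) -> #|N| * B <= Q * \sum_(x in N) h x ->
  #|N| * B ^ k <= (2 * Q) ^ k.+1 * \sum_(x in N) h x ^ k.
Proof.
move=> Q_gt0 hB dense; pose big := [set x in N | B <= 2 * Q * h x].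
have sum_big c : \sum_(x in N) (if x \in big then c else 0) = #|big| * c.
  rewrite -big_mkcondr -sum_nat_const; apply: eq_bigl => x.
  by rewrite !inE; case: (x \in N).
have big_dense : #|N| <= 2 * Q * #|big|.
  have [B0|B_gt0] := posnP B.
    rewrite (_ : big = N) ?leq_pmull ?muln_gt0 //.
    by apply/setP => x; rewrite !inE B0 andbT.
  rewrite -(leq_pmul2r B_gt0); have : 2 * Q * \sum_(x in N) h x <= 2 * Q * (#|big| * B) + #|N| * B.
    rewrite -sum_big -sum_nat_const !big_distrr -big_split /=; apply: leq_sum => x xN.
    rewrite inE xN /=; case: ifP => [_|/negbT]; last by rewrite -ltnNge muln0 => /ltnW.
    by rewrite (leq_trans _ (leq_addr _ _)) // leq_mul2l hB ?orbT.
  by move: dense; lia.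
apply: leq_trans (_ : 2 * Q * (#|big| * B ^ k) <= _).
  by rewrite mulnA leq_mul2r big_dense orbT.
rewrite expnS -[leqRHS]mulnA leq_mul2l -sum_big big_distrr /=; apply/orP; right.
apply: leq_sum => x xN; rewrite inE xN /=.
by case: ifP => // Bx; rewrite -expnMn leq_wexp2r.
Qed.

Section WeightedSums.
Local Open Scope ring_scope.

Lemma sumr_indicator (R : pzSemiRingType) (T : finType) (P : pred T) (F : T -> R) :
  \sum_(x | P x) F x = \sum_x (P x)%:R * F x.
Proof.
by rewrite big_mkcond; apply: eq_bigr => x _; case: (P x); rewrite ?mul1r ?mul0r.
Qed.

Lemma natr_card_set (R : pzSemiRingType) (T : finType) (P : pred T) :
  #|[set x | P x]|%:R = \sum_x (P x)%:R :> R.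
Proof.
rewrite -sum1dep_card natr_sum sumr_indicator.
by under eq_bigr do rewrite mulr1.
Qed.

Lemma sumr_delta (R : pzSemiRingType) (T : finType) (h : T -> R) (x0 : T) :
  \sum_x h x * (x == x0)%:R = h x0.
Proof.
rewrite (bigD1 x0) //= eqxx mulr1 big1 ?addr0 // => x /negPf ->.
by rewrite mulr0.
Qed.

Lemma prodr_natb (R : comPzSemiRingType) (I : finType) (P : pred I) :
  \prod_i (P i)%:R = [forall i, P i]%:R :> R.
Proof.
have [/forallP all|] := boolP [forall i, P i]; first by rewrite big1 // => i _; rewrite all.
by rewrite negb_forall => /existsP[i /negPf Pi]; rewrite (bigD1 i) //= Pi mul0r.
Qed.

Lemma prodr_const_neq (R : pzSemiRingType) (I : finType) (i : I) (x : R) :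
  \prod_(j | j != i) x = x ^+ #|I|.-1.
Proof. by rewrite prodr_const -(cardC1 i). Qed.

Lemma ltr_sum_exists (R : realDomainType) (I : finType) (P : pred I) (F G : I -> R) :
  \sum_(i | P i) F i < \sum_(i | P i) G i -> exists2 i, P i & F i < G i.
Proof.
move=> FG; have [i /andP[Pi FGi]|no] := pickP [pred i | P i && (F i < G i)]; first by exists i.
move: FG; rewrite ltNge => /negP[]; apply: ler_sum => i Pi.
by rewrite leNgt; have /= := no i; rewrite Pi /= => ->.
Qed.

Lemma ltn_sum_exists (I : finType) (P : pred I) (F G : I -> nat) :
  (\sum_(i | P i) F i < \sum_(i | P i) G i)%N -> exists2 i, P i & (F i < G i)%N.
Proof.
rewrite -(ltr_nat rat) !natr_sum => /ltr_sum_exists[i Pi].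
by rewrite ltr_nat; exists i.
Qed.

Lemma ler_sum_subset (R : numDomainType) (I : finType) (P Q : pred I) (w : I -> R) :
  (forall x, 0 <= w x) -> (forall x, P x -> Q x) -> \sum_(x | P x) w x <= \sum_(x | Q x) w x.
Proof.
move=> w_ge0 PQ; rewrite [leLHS]big_mkcond [leRHS]big_mkcond; apply: ler_sum => x _.
by case: ifP => [/PQ ->|_] //; case: ifP.
Qed.

Lemma ler_sum_cover (R : numDomainType) (I J : finType) (P : pred I) (A : pred J)
    (Q : J -> pred I) (w : I -> R) :
  (forall x, 0 <= w x) -> (forall x, P x -> exists2 j, A j & Q j x) ->
  \sum_(x | P x) w x <= \sum_(j | A j) \sum_(x | Q j x) w x.
Proof.
move=> w_ge0 cover; rewrite (exchange_big_dep xpredT) //= big_mkcond.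
apply: ler_sum => x _; case: ifP => [/cover[j Aj Qj]|_]; last exact: sumr_ge0.
by rewrite (bigD1 j) ?Aj //= lerDl sumr_ge0.
Qed.

Lemma ler_sum_predU (R : numDomainType) (I : finType) (P Q : pred I) (w : I -> R) :
  (forall x, 0 <= w x) ->
  \sum_(x | P x || Q x) w x <= \sum_(x | P x) w x + \sum_(x | Q x) w x.
Proof.
move=> w_ge0; rewrite [leLHS]big_mkcond (big_mkcond P) (big_mkcond Q) -big_split /=.
apply: ler_sum => x _; have := w_ge0 x.
by case: (P x) (Q x) => [] []; rewrite /= ?addr0 ?add0r ?lerDl.
Qed.
End WeightedSums.

(** * Product weights on finite functions *)

Section ProductWeights.
Variables (R : numDomainType) (J T : finType).
Implicit Type p : J -> T -> R.
Local Open Scope ring_scope.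

Lemma sum_prod_marginal p (j0 : J) (h : T -> R) :
  \sum_(g : {ffun J -> T}) h (g j0) * \prod_j p j (g j)
    = (\sum_v h v * p j0 v) * \prod_(j | j != j0) \sum_v p j v.
Proof.
pose q j v := (if j == j0 then h v else 1) * p j v.
transitivity (\sum_(g : {ffun J -> T}) \prod_j q j (g j)).
  apply: eq_bigr => g _; rewrite big_split /=; congr (_ * _).
  by rewrite (bigD1 j0) //= eqxx big1 ?mulr1 // => j /negPf ->.
rewrite -bigA_distr_bigA (bigD1 j0) //=; congr (_ * _).
  by apply: eq_bigr => v _; rewrite /q eqxx.
by apply: eq_bigr => j /negPf jN; apply: eq_bigr => v _; rewrite /q jN mul1r.
Qed.

Lemma sum_prod_coincide p (j j' : J) (m : R) : j != j' ->
  (forall i v, 0 <= p i v) -> (forall v, p j' v <= m) ->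
  \sum_(g : {ffun J -> T} | g j == g j') \prod_i p i (g i)
    <= m * \prod_(i | i != j') \sum_v p i v.
Proof.
move=> jj' p_ge0 p_le; pose q v i u : R := (if i == j' then (u == v)%:R else 1) * p i u.
have sum_q v i : i != j' -> \sum_u q v i u = \sum_u p i u.
  by move=> /negPf ij'; apply: eq_bigr => u _; rewrite /q ij' mul1r.
have sum_qj' v : \sum_u q v j' u = p j' v.
  rewrite -[RHS](sumr_delta (p j')); apply: eq_bigr => u _.
  by rewrite /q eqxx mulrC.
have -> : \sum_(g : {ffun J -> T} | g j == g j') \prod_i p i (g i)
    = \sum_v \sum_(g : {ffun J -> T}) (g j == v)%:R * \prod_i q v i (g i).
  rewrite exchange_big big_mkcond; apply: eq_bigr => g _ /=.
  have prod_q v : \prod_i q v i (g i) = (g j' == v)%:R * \prod_i p i (g i).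
    rewrite big_split /=; congr (_ * _).
    by rewrite (bigD1 j') //= eqxx big1 ?mulr1 // => i /negPf ->.
  under [RHS]eq_bigr => v _ do rewrite prod_q [g j == v]eq_sym mulrC.
  rewrite (sumr_delta (fun v => (g j' == v)%:R * _)) eq_sym.
  by case: eqP; rewrite ?mul1r ?mul0r.
rewrite [X in _ * X](bigD1 j) //= mulrCA mulr_suml; apply: ler_sum => v _.
rewrite (sum_prod_marginal (q v) j (fun u => (u == v)%:R)).
have -> : \sum_u (u == v)%:R * q v j u = p j v.
  rewrite -[RHS](sumr_delta (p j)); apply: eq_bigr => u _.
  by rewrite /q (negPf jj') mul1r mulrC.
apply: ler_wpM2l => //; rewrite (bigD1 j') 1?eq_sym //= sum_qj'.
under eq_bigl do rewrite andbC.
rewrite (eq_bigr _ (fun i ij => sum_q v i (proj1 (andP ij)))).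
by apply: ler_wpM2r => //; apply: prodr_ge0 => i _; apply: sumr_ge0.
Qed.

Lemma sum_prod_noninjective p (m B : R) :
  (forall j v, 0 <= p j v) -> (forall j v, p j v <= m) -> 0 <= m ->
  (forall j, \prod_(i | i != j) \sum_v p i v <= B) ->
  \sum_(g : {ffun J -> T} | ~~ injectiveb g) \prod_i p i (g i) <= (#|J| ^ 2)%:R * (m * B).
Proof.
move=> p_ge0 p_le m_ge0 prod_le.
apply: (@le_trans _ _ (\sum_(jj : J * J | jj.1 != jj.2)
    \sum_(g : {ffun J -> T} | g jj.1 == g jj.2) \prod_i p i (g i))).
  apply: ler_sum_cover => [g|g /injectivePn[j [j' jj' gE]]]; first exact: prodr_ge0.
  by exists (j, j') => //=; rewrite gE.
have mB_ge0 (jj : J * J) : 0 <= m * B.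
  rewrite mulr_ge0 // (le_trans _ (prod_le jj.1)) // prodr_ge0 // => i _.
  exact: sumr_ge0.
apply: le_trans (_ : \sum_(jj : J * J | jj.1 != jj.2) m * B <= _).
  apply: ler_sum => jj neq; apply: le_trans (sum_prod_coincide neq p_ge0 (p_le _)) _.
  exact: ler_wpM2l.
apply: le_trans (ler_sum_subset (Q := predT) _ _) _ => //.
by rewrite sumr_const card_prod mulnn mulr_natl.
Qed.
End ProductWeights.

Lemma card_noninjective_on (J T : finType) (N : {set T}) :
  #|[set f : {ffun J -> T} in ffun_on (mem N) | ~~ injectiveb f]| <= #|J| ^ 2 * #|N| ^ #|J|.-1.
Proof.
pose p (_ : J) v : rat := ((v \in N)%:R)%R.
have sum_p j : (\sum_v p j v = #|N|%:R)%R.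
  by rewrite -natr_card_set; congr (_%:R)%R; apply: eq_card => v; rewrite inE.
have := @sum_prod_noninjective _ _ _ p 1%R (#|N| ^ #|J|.-1)%:R _ _ _ _.
rewrite mul1r -natrM => noninj_le; rewrite -(ler_nat rat).
apply: le_trans (noninj_le _ _ _ _) => //; last 1 first.
- by move=> j; under eq_bigr do rewrite sum_p; rewrite prodr_const_neq natrX.
- rewrite natr_card_set [leRHS]big_mkcond; apply: ler_sum => f _.
  rewrite /p prodr_natb andbC; case: injectiveb => //=.
- by move=> j v; rewrite /p; case: (v \in N).
Qed.

Definition row_of (U V : finType) (r : nat) (g : {ffun U * 'I_r -> V}) (u : U) :
  {ffun 'I_r -> V} := [ffun j => g (u, j)].

Lemma big_rows (R : Type) (idx : R) (op : Monoid.com_law idx) (U V : finType) (r : nat)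
    (F : {ffun U -> {ffun 'I_r -> V}} -> R) :
  \big[op/idx]_(g : {ffun U * 'I_r -> V}) F [ffun u => row_of g u] = \big[op/idx]_g F g.
Proof.
rewrite [RHS](reindex (fun g : {ffun U * 'I_r -> V} => [ffun u => row_of g u])) //.
exists (fun h : {ffun U -> {ffun 'I_r -> V}} => [ffun a => h a.1 a.2]) => [g _|h _].
  by apply/ffunP => -[u j]; rewrite !ffunE.
by apply/ffunP => u; apply/ffunP => j; rewrite !ffunE.
Qed.

(** * Dense relations and greedy choices *)

Section DenseRelation.
Variables (V : finType) (N : {set V}) (r k : nat) (H : V -> {ffun 'I_r -> V} -> bool).

Lemma sum_common_related :
  \sum_(S : {ffun 'I_k * 'I_r -> V} | S \in ffun_on (mem N))
      #|[set x in N | [forall i, H x (row_of S i)]]|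
    = \sum_(x in N) #|[set S in ffun_on (mem N) | H x S]| ^ k.
Proof.
pose related x (S : {ffun 'I_r -> V}) := (S \in ffun_on (mem N)) && H x S.
have related_rows x (S : {ffun 'I_k * 'I_r -> V}) :
    (S \in ffun_on (mem N)) && [forall i, H x (row_of S i)]
    = ([ffun i => row_of S i] \in ffun_on [set S | related x S]).
  apply/andP/ffun_onP => [[/ffun_onP SN /forallP HS] i|HS].
    by rewrite ffunE inE /related HS andbT; apply/ffun_onP => j; rewrite ffunE.
  split; [apply/ffun_onP => -[i j]|apply/forallP => i]; have := HS i; rewrite ffunE inE.
    by case/andP=> /ffun_onP/(_ j); rewrite ffunE.
  by case/andP.
transitivity (\sum_(x in N) \sum_(S : {ffun 'I_k * 'I_r -> V}
    | (S \in ffun_on (mem N)) && [forall i, H x (row_of S i)]) 1).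
  rewrite [RHS](exchange_big_dep (fun S => S \in ffun_on (mem N))) /=; last by move=> x S _ /andP[].
  apply: eq_bigr => S SN; rewrite -sum1dep_card; apply: eq_bigl => x.
  by rewrite SN.
apply: eq_bigr => x _; rewrite -[k in RHS]card_ord -card_ffun_on -sum1_card.
rewrite [LHS]big_mkcond [RHS]big_mkcond.
rewrite -(@big_rows _ 0 addn _ _ _ (fun S => if S \in _ then 1 else 0)).
by apply: eq_bigr => S _; rewrite related_rows.
Qed.

Lemma dense_relation (m Q : nat) : 0 < Q ->
  #|N| ^ r.+1 <= Q * \sum_(x in N) #|[set S in ffun_on (mem N) | H x S]| ->
  (2 * Q) ^ k.+1 * (m + (k * r) ^ 2) < #|N| -> 0 < k * r ->
  exists S : {ffun 'I_k * 'I_r -> V},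
    [/\ injective S, forall a, S a \in N & m < #|[set x in N | [forall i, H x (row_of S i)]]|].
Proof.
move=> Q_gt0 dense N_big kr_gt0.
have N_gt0 : 0 < #|N| by apply: leq_trans N_big.
suff [S SN X_big] : exists2 S : {ffun 'I_k * 'I_r -> V}, S \in ffun_on (mem N)
    & m + #|N| * ~~ injectiveb S < #|[set x in N | [forall i, H x (row_of S i)]]|.
  exists S; split; first apply/injectiveP.
  - apply: contraTT X_big => /negPf ->; rewrite -leqNgt muln1.
    apply: leq_trans (leq_addl _ _); apply: subset_leq_card.
    by apply/subsetP => x; rewrite inE => /andP[].
  - by move=> a; move/ffun_onP: SN.
  - by apply: leq_ltn_trans X_big; apply: leq_addr.
apply: ltn_sum_exists; rewrite sum_common_related.
have noninj_le : \sum_(S : {ffun 'I_k * 'I_r -> V} | S \in ffun_on (mem N))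
    (m + #|N| * ~~ injectiveb S) <= (m + (k * r) ^ 2) * #|N| ^ (k * r).
  rewrite big_split /= sum_nat_const card_ffun_on card_prod !card_ord -big_distrr /=.
  rewrite mulnDl [_ * m]mulnC leq_add2l.
  rewrite -[X in _ <= _ * _ ^ X](prednK kr_gt0) (expnS #|N|) mulnCA leq_mul2l; apply/orP; right.
  have := @card_noninjective_on ('I_k * 'I_r)%type V N; rewrite card_prod !card_ord.
  apply: leq_trans; rewrite -sum1_card [leqLHS]big_mkcond [leqRHS]big_mkcond.
  by apply: leq_sum => S _; rewrite inE; case: (S \in _) (injectiveb S) => [] [].
have := sum_expn_ge k Q_gt0 _ (_ : #|N| * #|N| ^ r <= _); rewrite -expnS -expnM.
move=> /(_ _ _ dense) many.
rewrite -(ltn_pmul2l (_ : 0 < (2 * Q) ^ k.+1)) ?expn_gt0 ?muln_gt0 ?Q_gt0 //.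
apply: leq_trans (many _) => [|x _].
  rewrite [r * k]mulnC; apply: leq_ltn_trans (leq_mul (leqnn _) noninj_le) _.
  by rewrite mulnA ltn_mul2r expn_gt0 N_gt0.
rewrite -[r in _ ^ r]card_ord -card_ffun_on -[leqRHS]cardsE; apply: subset_leq_card.
by apply/subsetP => S; rewrite !inE => /andP[].
Qed.
End DenseRelation.

Lemma greedy_choice (M : Type) (compat : M -> M -> Prop) (l : nat) (P : 'I_l -> M -> Prop) :
  (forall a b, compat a b -> compat b a) ->
  (forall n (x : 'I_n -> M) (j : 'I_l), n < l -> exists2 m, P j m & forall i, compat m (x i)) ->
  exists2 x : 'I_l -> M, forall j, P j (x j) & forall j j', j != j' -> compat (x j) (x j').
Proof.
move=> compatC; elim: l P => [|l IH] P extend; first by exists (ffun0 (card_ord 0)) => -[].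
have [|x Px compat_x] := IH (fun j => P (lift ord_max j)).
  by move=> n x j nl; apply: extend; apply: ltnW.
have [m Pm compat_m] := extend l x ord_max (ltnSn l).
exists (fun j => if unlift ord_max j is Some i then x i else m) => [j|j j'].
  by case: unliftP => [i|] ->.
case: unliftP => [i|] ->; case: unliftP => [i'|] -> //; last by rewrite eqxx.
  by rewrite (inj_eq lift_inj); apply: compat_x.
by move=> _; apply: compatC.
Qed.

Lemma greedy_representatives (V I : finType) (A : I -> {set V}) (Z : {set V}) :
  (forall i, #|Z| + #|I| <= #|A i|) ->
  exists y : I -> V, [/\ injective y, forall i, y i \in A i & forall i, y i \notin Z].
Proof.
move=> A_big.
have [||x xA x_neq] := @greedy_choice V (fun v v' => v != v') #|I|
  (fun j v => v \in A (enum_val j) :\: Z).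
- by move=> v v'; rewrite eq_sym.
- move=> n x j n_lt; have : 0 < #|A (enum_val j) :\: (Z :|: x @: setT)|.
    rewrite cardsD subn_gt0; apply: leq_ltn_trans (subset_leq_card (subsetIr _ _)) _.
    apply: leq_trans (A_big (enum_val j)); apply: leq_ltn_trans (leq_card_setU _ _) _.
    by rewrite ltn_add2l (leq_ltn_trans (leq_card_imsetT _)) // card_ord.
  case/card_gt0P=> v; rewrite !inE negb_or -andbA => /and3P[vZ vx vA]; exists v.
    by rewrite inE vZ.
  by move=> i; apply: contraNneq vx => ->; apply: imset_f.
exists (fun i => x (enum_rank i)); split=> [i i' E|i|i].
- apply: enum_rank_inj; apply/eqP; apply: contraTT isT => /x_neq.
  by rewrite E eqxx.
- by have := xA (enum_rank i); rewrite enum_rankK inE => /andP[].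
- by have := xA (enum_rank i); rewrite inE => /andP[].
Qed.

Section GreedyDisjoint.
Variables (R : realDomainType) (V M : finType) (P : pred M) (weight : M -> R).
Variables (support : M -> {set V}) (cap : R).
Local Open Scope ring_scope.
Hypothesis weight_ge0 : forall m, 0 <= weight m.
Hypothesis weight_le : forall v, \sum_(m | P m && (v \in support m)) weight m <= cap.

Lemma exists_disjoint (Z : {set V}) :
  #|Z|%:R * cap < \sum_(m | P m) weight m -> exists2 m, P m & [disjoint support m & Z].
Proof.
move=> total; have [m /andP[Pm mZ]|meet] := pickP [pred m | P m && [disjoint support m & Z]].
  by exists m.
have : \sum_(m | P m) weight m <= #|Z|%:R * cap; last by rewrite leNgt total.
apply: (@le_trans _ _ (\sum_(v in Z) \sum_(m | P m && (v \in support m)) weight m)).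
  apply: ler_sum_cover => // m Pm; have /negbT := meet m.
  rewrite /= Pm disjoint_sym disjoint_subset => /subsetPn[v vZ]; rewrite inE negbK => vm.
  by exists v => //; rewrite Pm.
by apply: le_trans (ler_sum _ (fun v _ => weight_le v)) _; rewrite sumr_const mulr_natl.
Qed.

Lemma greedy_disjoint (Z : {set V}) (l c : nat) : 0 <= cap -> (forall m, #|support m| <= c)%N ->
  (#|Z| + l * c)%:R * cap < \sum_(m | P m) weight m ->
  exists x : 'I_l -> M, [/\ forall j, P (x j), forall j, [disjoint support (x j) & Z]
    & forall j j', j != j' -> [disjoint support (x j) & support (x j')]].
Proof.
move=> cap_ge0 support_le total.
have [|n x j n_lt|x xPZ xx] := @greedy_choice M (fun m m' => [disjoint support m & support m']) l
  (fun _ m => P m && [disjoint support m & Z]).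
- by move=> m m'; rewrite disjoint_sym.
- pose Z' := Z :|: \bigcup_i support (x i).
  have [|m Pm mZ'] := @exists_disjoint Z'.
    apply: le_lt_trans total; rewrite ler_wpM2r // ler_nat.
    apply: leq_trans (leq_card_setU _ _) _; rewrite leq_add2l.
    apply: (@leq_trans (n * c)); last by rewrite leq_mul // ltnW.
    rewrite -[n in (n * c)%N]card_ord -sum_nat_const.
    apply: leq_trans (_ : \sum_i #|support (x i)| <= _)%N; last exact: leq_sum.
    elim/big_rec2: _ => [|i a B _ IH]; first by rewrite cards0.
    by apply: leq_trans (leq_card_setU _ _) _; rewrite leq_add2l.
  exists m; first by rewrite Pm (disjointWr _ mZ') // subsetUl.
  by move=> i; rewrite (disjointWr _ mZ') // (subset_trans _ (subsetUr _ _)) // (bigcup_sup i).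
by exists x; split=> // j; case/andP: (xPZ j).
Qed.
End GreedyDisjoint.

Definition common_size (k r l : nat) : nat :=
  (2 * (4 * (8 * k).+1)) ^ k.+1 * (k * r + l + (k * r) ^ 2).

Definition star_centres (V : finType) (e : rel V) (r : nat) (x : V) (S : 'I_r -> V) : {set V} :=
  [set y | e y x && [forall j, e y (S j)]].

Section CommonNeighbourhood.
Variables (V : finType) (e : rel V) (k r l : nat) (N X : {set V}).
Variables (S0 : 'I_r -> V) (S : 'I_k * 'I_r -> V).
Hypotheses (e_sym : symmetric e) (e_irr : irreflexive e).
Hypotheses (S0_inj : injective S0) (S0_N : forall j v, v \in N -> e (S0 j) v).
Hypotheses (S_inj : injective S) (SN : forall a, S a \in N).
Hypotheses (XN : X \subset N) (X_big : k * r + l <= #|X|).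
Hypothesis centres_big : forall x i, x \in X ->
  r + k * r + l + l * k <= #|star_centres e x (fun j => S (i, j))|.

(* [S0] becomes the roots of the centre and [S] the roots of the satellites: the centres are taken
   in [N], the satellites outside of everything chosen before. *)
Lemma common_neighbourhood_embedding : blowup_embedding e k r l.
Proof.
have [|x [x_inj xX xS]] := @greedy_representatives V 'I_l (fun=> X) (S @: setT).
  move=> _; apply: leq_trans X_big; rewrite card_ord leq_add2r.
  by rewrite (leq_trans (leq_card_imsetT _)) // card_prod !card_ord.
pose Z := S0 @: setT :|: S @: setT :|: x @: setT.
have Z_small : #|Z| <= r + k * r + l.
  apply: leq_trans (leq_card_setU _ _) _; apply: leq_add; last first.
    by rewrite (leq_trans (leq_card_imsetT _)) // card_ord.
  apply: leq_trans (leq_card_setU _ _) _.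
  apply: leq_add; rewrite (leq_trans (leq_card_imsetT _)) //.
    by rewrite card_ord.
  by rewrite card_prod !card_ord.
have [|y [y_inj y_centre yZ]] := @greedy_representatives V ('I_l * 'I_k)%type
    (fun a => star_centres e (x a.1) (fun j => S (a.2, j))) Z.
  move=> [j i] /=; apply: leq_trans (centres_big i (xX j)).
  by rewrite card_prod !card_ord leq_add2r.
have xN j : x j \in N by apply: (subsetP XN).
have S0_neq j v : v \in N -> S0 j <> v by move=> /(S0_N j) + E; rewrite E e_irr.
have y_neqS0 a j : y a <> S0 j by move=> E; have := yZ a; rewrite E !inE imset_f.
have y_neqS a b : y a <> S b by move=> E; have := yZ a; rewrite E !inE imset_f ?orbT.
have y_neqx a j : y a <> x j by move=> E; have := yZ a; rewrite E !inE imset_f ?orbT.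
exists (fun a => if a.1 is Some i then S (i, a.2) else S0 a.2),
  (fun j u => if u is Some i then y (j, i) else x j); split.
- case=> [[i|] j] [[i'|] j'] /= E; first by case: (S_inj E) => -> ->.
  + by case: (S0_neq j' _ (SN (i, j))).
  + by case: (S0_neq j _ (SN (i', j'))).
  + by rewrite (S0_inj E).
- move=> j [i|] j' [i'|] E; first by case: (y_inj _ _ E) => -> ->.
  + by case: (y_neqx (j, i) j').
  + by case: (y_neqx (j', i') j).
  + by rewrite (x_inj _ _ E).
- move=> j [i|] [[i'|] j'] /= E; first by case: (y_neqS (j, i) (i', j')).
  + by case: (y_neqS0 (j, i) j').
  + by have := xS j; rewrite E imset_f.
  + by case: (S0_neq j' _ (xN j)).
- move=> j [i|] j' /=; last by rewrite e_sym S0_N.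
  by have := y_centre (j, i); rewrite inE => /andP[_ /forallP].
- by move=> j i /=; rewrite e_sym; have := y_centre (j, i); rewrite inE => /andP[].
Qed.
End CommonNeighbourhood.

(** * Tree-indexed random walk *)

Section RandomWalk.
Variables (R : realFieldType) (V : finType) (e : rel V) (d r : nat).
Hypotheses (e_sym : symmetric e) (d_gt0 : 0 < d).
Hypothesis (deg_ge : forall x, d <= #|neighbours e x|).
Local Open Scope ring_scope.

Notation rtuple := {ffun 'I_r -> V}.

Definition degree (x : V) : R := #|neighbours e x|%:R.
Definition adj (x y : V) : R := (e x y)%:R.
Definition step (x y : V) : R := adj x y / degree x.
Definition steps (y : V) (S : rtuple) : R := \prod_j step y (S j).
Definition codegree_term (y x : V) (S : rtuple) : R := adj y x * steps y S.
Definition codegree (x : V) (S : rtuple) : R := \sum_y codegree_term y x S.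
Definition volume : R := \sum_x degree x.

Lemma degree_ge x : d%:R <= degree x. Proof. by rewrite ler_nat. Qed.
Lemma degree_gt0 x : 0 < degree x. Proof. by rewrite ltr0n (leq_trans d_gt0). Qed.
Lemma adj_ge0 x y : 0 <= adj x y. Proof. exact: ler0n. Qed.
Lemma adjC x y : adj x y = adj y x. Proof. by rewrite /adj e_sym. Qed.
Lemma sum_adj x : \sum_y adj x y = degree x. Proof. by rewrite /degree natr_card_set. Qed.
Lemma step_ge0 x y : 0 <= step x y. Proof. by rewrite divr_ge0 ?adj_ge0 ?ler0n. Qed.

Lemma step_le x y : step x y <= d%:R^-1.
Proof.
apply: (@le_trans _ _ (degree x)^-1).
  by rewrite ler_piMl ?invr_ge0 ?ler0n // /adj; case: e; rewrite ?ler01.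
by rewrite lef_pV2 ?degree_ge // posrE ?degree_gt0 ?ltr0n.
Qed.

Lemma sum_step x : \sum_y step x y = 1.
Proof. by rewrite -mulr_suml sum_adj divff // gt_eqF ?degree_gt0. Qed.

Lemma step_neq0 x y : step x y != 0 -> e x y.
Proof. by rewrite /step /adj; case: e => //; rewrite mul0r eqxx. Qed.

Lemma steps_ge0 y S : 0 <= steps y S.
Proof. by apply: prodr_ge0 => j _; apply: step_ge0. Qed.

Lemma steps_le y S : steps y S <= (d%:R ^+ r)^-1.
Proof.
rewrite -exprVn -[r in leRHS]card_ord -prodr_const; apply: ler_prod => j _.
by rewrite step_ge0 step_le.
Qed.

Lemma sum_steps y : \sum_S steps y S = 1.
Proof. by rewrite -(bigA_distr_bigA (fun=> step y)) big1 // => j _; rewrite sum_step. Qed.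

Lemma steps_neq0 y S : steps y S != 0 -> forall j, e y (S j).
Proof. by move=> /prodf_neq0 nz j; apply/step_neq0/nz. Qed.

Lemma codegree_term_ge0 y x S : 0 <= codegree_term y x S.
Proof. by rewrite mulr_ge0 ?adj_ge0 ?steps_ge0. Qed.

Lemma codegree_term_le y x S : codegree_term y x S <= (d%:R ^+ r)^-1.
Proof.
rewrite /codegree_term /adj; case: (e y x); rewrite ?mul1r ?mul0r ?steps_le //.
by rewrite invr_ge0 exprn_ge0 ?ler0n.
Qed.

Lemma codegree_ge0 x S : 0 <= codegree x S.
Proof. by apply: sumr_ge0 => y _; apply: codegree_term_ge0. Qed.

Lemma sum_codegree : \sum_x \sum_S codegree x S = volume.
Proof.
under eq_bigr => x _ do rewrite exchange_big /=.
rewrite exchange_big /=; apply: eq_bigr => y _.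
under eq_bigr => x _ do rewrite -mulr_sumr sum_steps mulr1.
exact: sum_adj.
Qed.

Lemma volume_ge : (#|V| * d)%:R <= volume.
Proof. by rewrite natrM mulr_natl -sumr_const; apply: ler_sum => x _; apply: degree_ge. Qed.

Section TreeWalk.
Variable k : nat.
Notation skeleton := (V * {ffun 'I_k -> V})%type.
Notation roots := {ffun option 'I_k * 'I_r -> V}.

Definition inner (m : skeleton) (u : option 'I_k) : V := oapp m.2 m.1 u.
Definition skeleton_weight (m : skeleton) : R := degree m.1 * \prod_i step m.1 (m.2 i).
(* [tree_weight m g / volume] is the law of the stationary random walk indexed by the tree, with
   centre [m.1], satellites [m.2] and roots [g]. *)
Definition tree_weight (m : skeleton) (g : roots) : R :=
  skeleton_weight m * \prod_u steps (inner m u) (row_of g u).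

Lemma skeleton_weight_ge0 m : 0 <= skeleton_weight m.
Proof. by rewrite mulr_ge0 ?ler0n ?prodr_ge0 // => i _; rewrite step_ge0. Qed.

Lemma tree_weight_ge0 m g : 0 <= tree_weight m g.
Proof. by rewrite mulr_ge0 ?skeleton_weight_ge0 ?prodr_ge0 // => i _; rewrite steps_ge0. Qed.

Lemma tree_weight_neq0 m g : tree_weight m g != 0 ->
  (forall i, e m.1 (m.2 i)) /\ forall u j, e (inner m u) (g (u, j)).
Proof.
rewrite !mulf_eq0 !negb_or -andbA => /and3P[_ /prodf_neq0 skel /prodf_neq0 rows].
split=> [i|u j]; first exact/step_neq0/skel.
by have := steps_neq0 (rows u isT) j; rewrite ffunE.
Qed.

Lemma sum_skeleton (F : skeleton -> R) : \sum_m F m = \sum_x \sum_y F (x, y).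
Proof. by rewrite pair_bigA; apply: eq_bigr => -[]. Qed.

Lemma sum_skeleton_weight_centre x : \sum_y skeleton_weight (x, y) = degree x.
Proof.
rewrite /skeleton_weight /= -mulr_sumr -(bigA_distr_bigA (fun=> step x)).
rewrite big1 ?mulr1 // => i _.
exact: sum_step.
Qed.

Lemma sum_skeleton_weight : \sum_m skeleton_weight m = volume.
Proof.
by rewrite sum_skeleton; apply: eq_bigr => x _; apply: sum_skeleton_weight_centre.
Qed.

Lemma sum_skeleton_edge i (h : V -> V -> R) :
  \sum_(m : skeleton) h m.1 (m.2 i) * skeleton_weight m = \sum_x \sum_v h x v * adj x v.
Proof.
rewrite sum_skeleton; apply: eq_bigr => x _; rewrite /skeleton_weight /=.
under eq_bigr => y _ do rewrite mulrCA.
rewrite -mulr_sumr (sum_prod_marginal (fun=> step x) i (h x)).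
rewrite [X in _ * (_ * X)]big1 => [|j _]; last exact: sum_step.
rewrite mulr1 mulr_sumr; apply: eq_bigr => v _.
by rewrite mulrCA [_ * step x v]mulrC divfK // gt_eqF ?degree_gt0.
Qed.

Lemma sum_tree_weight_row m u (h : rtuple -> R) :
  \sum_g h (row_of g u) * tree_weight m g
    = skeleton_weight m * \sum_S h S * steps (inner m u) S.
Proof.
have := sum_prod_marginal (fun v => steps (inner m v)) u h.
rewrite [X in _ * X]big1 => [|v _]; last exact: sum_steps.
rewrite mulr1 => <-; rewrite mulr_sumr.
rewrite -(@big_rows R 0 +%R _ _ _ (fun g : {ffun option 'I_k -> rtuple} =>
  skeleton_weight m * (h (g u) * \prod_v steps (inner m v) (g v)))).
apply: eq_bigr => g _; rewrite ffunE mulrCA; congr (_ * (_ * _)).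
by apply: eq_bigr => v _; rewrite ffunE.
Qed.

Lemma sum_tree_weight m : \sum_g tree_weight m g = skeleton_weight m.
Proof.
have := sum_tree_weight_row m None (fun=> 1).
under eq_bigr do rewrite mul1r; move=> ->.
by under eq_bigr do rewrite mul1r; rewrite sum_steps mulr1.
Qed.

Definition mass (P : pred (skeleton * roots)) : R := \sum_(c | P c) tree_weight c.1 c.2.

Lemma mass_pair (P : skeleton -> pred roots) :
  mass (fun c => P c.1 c.2) = \sum_m \sum_(g | P m g) tree_weight m g.
Proof. by rewrite /mass (pair_big_dep xpredT P (fun m g => tree_weight m g)). Qed.

Lemma massT : mass xpredT = volume.
Proof.
rewrite (mass_pair (fun _ _ => true)) -sum_skeleton_weight.
by apply: eq_bigr => m _; apply: sum_tree_weight.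
Qed.

Lemma mass_satellites_noninjective :
  mass (fun c => ~~ injectiveb c.1.2) <= (k ^ 2)%:R / d%:R * volume.
Proof.
rewrite (mass_pair (fun m _ => ~~ injectiveb m.2)).
rewrite (eq_bigr (fun m : skeleton => (~~ injectiveb m.2)%:R * skeleton_weight m)); last first.
  move=> m _; case: (injectiveb _); first by rewrite big_pred0 ?mul0r.
  by rewrite mul1r -sum_tree_weight.
rewrite sum_skeleton mulr_sumr; apply: ler_sum => x _.
rewrite -sumr_indicator /skeleton_weight /= -mulr_sumr mulrC ler_wpM2r ?ler0n //.
have := @sum_prod_noninjective R 'I_k V (fun=> step x) d%:R^-1 1
  (fun _ => step_ge0 x) (fun _ => step_le x) _ _.
rewrite card_ord mulr1; apply; first by rewrite invr_ge0 ler0n.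
by move=> i; rewrite big1 // => j _; rewrite sum_step.
Qed.

Lemma mass_roots_noninjective :
  mass (fun c => ~~ injectiveb c.2) <= ((k.+1 * r) ^ 2)%:R / d%:R * volume.
Proof.
have steps_prod m (g : roots) :
    \prod_u steps (inner m u) (row_of g u) = \prod_a step (inner m a.1) (g a).
  by rewrite /steps pair_big; apply: eq_bigr => -[u j] _; rewrite ffunE.
rewrite (mass_pair (fun _ g => ~~ injectiveb g)) -sum_skeleton_weight mulr_sumr.
apply: ler_sum => m _; rewrite -mulr_sumr mulrC ler_wpM2r ?skeleton_weight_ge0 //.
under eq_bigr => g _ do rewrite steps_prod.
have := @sum_prod_noninjective R (option 'I_k * 'I_r)%type V (fun a => step (inner m a.1))
  d%:R^-1 1 (fun _ => step_ge0 _) (fun _ => step_le _) _ _.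
rewrite card_prod card_option !card_ord mulr1; apply; first by rewrite invr_ge0 ler0n.
by move=> i; rewrite big1 // => j _; rewrite sum_step.
Qed.

Section StarPredicate.
Variable is_heavy : V -> rtuple -> bool.

Definition heavy_volume : R := \sum_x \sum_S (is_heavy x S)%:R * codegree x S.

Lemma mass_centre_heavy i : mass (fun c => is_heavy c.1.1 (row_of c.2 (Some i))) = heavy_volume.
Proof.
rewrite (mass_pair (fun m g => is_heavy m.1 (row_of g (Some i)))).
under eq_bigr => m _.
  rewrite sumr_indicator (sum_tree_weight_row m (Some i) (fun S => (is_heavy m.1 S)%:R)).
  rewrite mulrC; over.
rewrite (sum_skeleton_edge i (fun x v => \sum_S (is_heavy x S)%:R * steps v S)).
apply: eq_bigr => x _; under eq_bigr => v _ do rewrite mulr_suml.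
rewrite exchange_big /=; apply: eq_bigr => S _; rewrite mulr_sumr.
by apply: eq_bigr => v _; rewrite -mulrA [steps _ _ * _]mulrC adjC.
Qed.

Lemma mass_satellite_heavy i : mass (fun c => is_heavy (c.1.2 i) (row_of c.2 None)) = heavy_volume.
Proof.
rewrite (mass_pair (fun m g => is_heavy (m.2 i) (row_of g None))).
under eq_bigr => m _.
  rewrite sumr_indicator (sum_tree_weight_row m None (fun S => (is_heavy (m.2 i) S)%:R)).
  rewrite mulrC; over.
rewrite (sum_skeleton_edge i (fun x v => \sum_S (is_heavy v S)%:R * steps x S)) exchange_big.
apply: eq_bigr => v _; under eq_bigr => x _ do rewrite mulr_suml.
rewrite exchange_big /=; apply: eq_bigr => S _; rewrite mulr_sumr.
by apply: eq_bigr => x _; rewrite -mulrA [steps _ _ * _]mulrC.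
Qed.

Definition light (m : skeleton) (g : roots) : bool :=
  [&& injectiveb m.2, injectiveb g, [forall i, ~~ is_heavy m.1 (row_of g (Some i))]
    & [forall i, ~~ is_heavy (m.2 i) (row_of g None)]].

Lemma mass_light_ge :
  volume - (((k ^ 2)%:R + ((k.+1 * r) ^ 2)%:R) / d%:R * volume + (2 * k)%:R * heavy_volume)
    <= mass (fun c => light c.1 c.2).
Proof.
have weight_ge0 (c : skeleton * roots) : 0 <= tree_weight c.1 c.2 by apply: tree_weight_ge0.
have sum_heavy : (2 * k)%:R * heavy_volume = k%:R * heavy_volume + k%:R * heavy_volume.
  by rewrite natrM; ring.
rewrite -[X in X - _]massT [X in X - _](bigID (fun c => light c.1 c.2)) /=.
rewrite lerBlDr lerD2l mulrDl mulrDl sum_heavy.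
pose centre_heavy (c : skeleton * roots) := [exists i, is_heavy c.1.1 (row_of c.2 (Some i))].
pose satellite_heavy (c : skeleton * roots) := [exists i, is_heavy (c.1.2 i) (row_of c.2 None)].
apply: (@le_trans _ _ (mass (fun c => (~~ injectiveb c.1.2 || ~~ injectiveb c.2)
    || (centre_heavy c || satellite_heavy c)))).
  by apply: ler_sum_subset => // c; rewrite /light -!negb_exists !negb_and !negbK -!orbA.
apply: le_trans (ler_sum_predU _ _ _) _ => //; apply: lerD.
  apply: le_trans (ler_sum_predU _ _ _) _ => //; apply: lerD.
    exact: mass_satellites_noninjective.
  exact: mass_roots_noninjective.
have cover (Q : 'I_k -> pred (skeleton * roots)) : (forall i, mass (Q i) = heavy_volume) ->
    mass (fun c => [exists i, Q i c]) <= k%:R * heavy_volume.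
  move=> massQ; apply: le_trans (ler_sum_cover (A := predT) (Q := Q) _ _) _ => //.
    by move=> c /existsP[i Qi]; exists i.
  under eq_bigr => i _ do rewrite -/(mass (Q i)) massQ.
  by rewrite sumr_const card_ord mulr_natl.
apply: le_trans (ler_sum_predU _ _ _) _ => //; apply: lerD; apply: cover.
  exact: mass_centre_heavy.
exact: mass_satellite_heavy.
Qed.
End StarPredicate.
End TreeWalk.

Section Threshold.
Variable L : nat.

Definition threshold : R := L%:R / d%:R ^+ r.
Definition heavy (x : V) (S : rtuple) : bool := threshold <= codegree x S.

Let dr_gt0 : 0 < d%:R ^+ r :> R. Proof. by rewrite exprn_gt0 ?ltr0n. Qed.

Lemma threshold_ge0 : 0 <= threshold. Proof. by rewrite divr_ge0 ?exprn_ge0 ?ler0n. Qed.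

Section LightStars.
Variables (k l : nat).
Hypothesis k_gt0 : (0 < k)%N.
Notation skeleton := (V * {ffun 'I_k -> V})%type.

Definition vertex_cap : R := threshold / d%:R ^+ r * (threshold / d%:R) ^+ k.-1.

Lemma satellites_cap_ge0 : 0 <= (threshold / d%:R) ^+ k.-1.
Proof. by rewrite exprn_ge0 // divr_ge0 ?threshold_ge0 ?ler0n. Qed.

Lemma vertex_cap_ge0 : 0 <= vertex_cap.
Proof. by rewrite mulr_ge0 ?satellites_cap_ge0 // divr_ge0 ?threshold_ge0 // ltW. Qed.

Lemma vertex_capE : vertex_cap = L%:R ^+ k * d%:R / d%:R ^+ tree_size k r.
Proof.
have d_neq0 n : d%:R ^+ n != 0 :> R by rewrite expf_eq0 pnatr_eq0 eqn0Ngt d_gt0 andbF.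
rewrite /vertex_cap /threshold /tree_size -[in RHS](prednK k_gt0).
rewrite exprD [(_ * r)%N]mulnC exprM !exprS !exprMn !exprVn.
move: (d_neq0 1%N) (d_neq0 r) (d_neq0 k.-1) (expf_neq0 k.-1 (d_neq0 r)); rewrite expr1.
set D := d%:R ^+ r; set b := D ^+ k.-1; set c := d%:R ^+ k.-1 => d0 D0 c0 b0.
by field; rewrite d0 D0 c0 b0.
Qed.

Section FixedRoots.
Variable g : {ffun option 'I_k * 'I_r -> V}.

Lemma tree_weight_centre x y :
  tree_weight (x, y) g = degree x * steps x (row_of g None)
    * \prod_i (step x (y i) * steps (y i) (row_of g (Some i))).
Proof.
rewrite /tree_weight /skeleton_weight (bigD1 None) //= [in RHS]big_split /=.
rewrite (reindex_omap Some id) /=; last by case.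
rewrite mulrACA; congr (_ * (_ * _)).
by apply: eq_big => [i|i _]; rewrite ?eqxx.
Qed.

Lemma sum_step_mul_steps x S : \sum_z step x z * steps z S = codegree x S / degree x.
Proof.
rewrite mulr_suml; apply: eq_bigr => z _.
by rewrite /step /codegree_term (adjC x) mulrAC.
Qed.

Definition centre_light (x : V) : bool := [forall i, ~~ heavy x (row_of g (Some i))].

Lemma codegree_lt_threshold x i : centre_light x -> codegree x (row_of g (Some i)) < threshold.
Proof. by move=> /forallP/(_ i); rewrite ltNge. Qed.

Lemma sum_tree_weight_satellite_le x i v : centre_light x ->
  \sum_(y : {ffun 'I_k -> V} | y i == v) tree_weight (x, y) g
    <= adj x v * steps x (row_of g None) * steps v (row_of g (Some i))
       * (threshold / d%:R) ^+ k.-1.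
Proof.
move=> x_light; under eq_bigr => y _ do rewrite tree_weight_centre.
rewrite -mulr_sumr sumr_indicator.
rewrite (sum_prod_marginal (fun j z => step x z * steps z (row_of g (Some j))) i
  (fun z => (z == v)%:R)).
under [X in _ * (X * _)]eq_bigr => z _ do rewrite mulrC.
rewrite (sumr_delta (fun z => step x z * steps z (row_of g (Some i)))).
under [X in _ * (_ * X)]eq_bigr => j _ do rewrite sum_step_mul_steps.
have -> (s t p : R) : degree x * s * (step x v * t * p) = adj x v * s * t * p.
  by rewrite /step; field; rewrite gt_eqF ?degree_gt0.
apply: ler_wpM2l; first by rewrite !mulr_ge0 ?steps_ge0 ?adj_ge0.
rewrite -[k in k.-1]card_ord -(prodr_const_neq i); apply: ler_prod => j _.
rewrite divr_ge0 ?codegree_ge0 ?ler0n //=; apply: ler_pM; rewrite ?codegree_ge0 ?invr_ge0 ?ler0n //.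
  exact: ltW (codegree_lt_threshold j x_light).
by rewrite lef_pV2 ?posrE ?degree_gt0 ?degree_ge ?ltr0n.
Qed.

Lemma light_weight_satellite v i :
  \sum_(m : skeleton | light heavy m g && (m.2 i == v)) tree_weight m g <= vertex_cap.
Proof.
have [v_heavy|] := boolP (heavy v (row_of g None)).
  rewrite big_pred0 ?vertex_cap_ge0 // => m; apply/negbTE/negP.
  by case/andP=> /and4P[_ _ _ /forallP/(_ i)] + /eqP mv; rewrite mv v_heavy.
rewrite -ltNge => /ltW v_light.
apply: (@le_trans _ _ (\sum_(m : skeleton | centre_light m.1 && (m.2 i == v)) tree_weight m g)).
  apply: ler_sum_subset => [m|m /andP[/and4P[_ _ m_light _] ->]]; first exact: tree_weight_ge0.
  by rewrite andbT.
rewrite -(pair_big_dep centre_light (fun _ (y : {ffun 'I_k -> V}) => y i == v)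
  (fun x y => tree_weight (x, y) g)) /=.
apply: le_trans (ler_sum _ (fun x => @sum_tree_weight_satellite_le x i v)) _.
rewrite -mulr_suml ler_wpM2r ?satellites_cap_ge0 // -mulr_suml ler_pM ?steps_ge0 ?steps_le //.
  by apply: sumr_ge0 => x _; rewrite mulr_ge0 ?adj_ge0 ?steps_ge0.
apply: le_trans v_light; apply: ler_sum_subset => // x; exact: codegree_term_ge0.
Qed.

Lemma light_weight_centre v :
  \sum_(m : skeleton | light heavy m g && (m.1 == v)) tree_weight m g <= vertex_cap.
Proof.
have [v_light|v_heavy] := boolP (centre_light v); last first.
  rewrite big_pred0 ?vertex_cap_ge0 // => m; apply/negbTE/negP.
  by case/andP=> /and4P[_ _ m_light _] /eqP mv; move: v_heavy; rewrite -mv /centre_light m_light.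
pose i0 := Ordinal k_gt0.
apply: (@le_trans _ _ (\sum_(m : skeleton | (m.1 == v) && true) tree_weight m g)).
  by apply: ler_sum_subset => [m|m /andP[_ ->] //]; exact: tree_weight_ge0.
rewrite -(pair_big_dep (pred1 v) (fun _ _ => true) (fun x y => tree_weight (x, y) g)) big_pred1_eq.
rewrite (partition_big (fun y : {ffun 'I_k -> V} => y i0) predT) //=.
apply: le_trans (ler_sum _ (fun v' _ => sum_tree_weight_satellite_le i0 v' v_light)) _.
rewrite -mulr_suml ler_wpM2r ?satellites_cap_ge0 //.
under eq_bigr => v' _ do rewrite adjC mulrAC.
rewrite -mulr_suml ler_pM ?steps_ge0 ?steps_le ?codegree_ge0 //.
exact: ltW (codegree_lt_threshold i0 v_light).
Qed.

Definition support (m : skeleton) : {set V} := [set inner m u | u : option 'I_k].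

Lemma light_weight_support v :
  \sum_(m : skeleton | (light heavy m g && (tree_weight m g != 0)) && (v \in support m))
    tree_weight m g <= k.+1%:R * vertex_cap.
Proof.
apply: le_trans (ler_sum_cover (A := predT)
  (Q := fun u m => light heavy m g && (inner m u == v)) _ _) _.
- by move=> m; apply: tree_weight_ge0.
- by move=> m /andP[/andP[m_light _] /imsetP[u _ ->]]; exists u; rewrite ?m_light ?eqxx.
have -> : k.+1%:R * vertex_cap = \sum_(u : option 'I_k) vertex_cap.
  by rewrite sumr_const card_option card_ord mulr_natl.
apply: ler_sum => -[i|] _; first exact: light_weight_satellite.
exact: light_weight_centre.
Qed.

Hypothesis e_irr : irreflexive e.

Lemma inner_inj (m : skeleton) : injective m.2 -> (forall i, e m.1 (m.2 i)) -> injective (inner m).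
Proof.
move=> m_inj m_edge; have neq i : m.1 <> m.2 i by move=> E; have := m_edge i; rewrite -E e_irr.
by case=> [i|] [i'|] //= E; [rewrite (m_inj _ _ E) | case: (neq i) | case: (neq i')].
Qed.

Lemma light_embedding_at : injective g ->
  (k.+1 * r + l * k.+1)%:R * (k.+1%:R * vertex_cap) < \sum_(m | light heavy m g) tree_weight m g ->
  blowup_embedding e k r l.
Proof.
move=> g_inj total; pose P m := light heavy m g && (tree_weight m g != 0).
have cap_ge0 : 0 <= k.+1%:R * vertex_cap by rewrite mulr_ge0 ?ler0n ?vertex_cap_ge0.
have sumP : \sum_(m | P m) tree_weight m g = \sum_(m | light heavy m g) tree_weight m g.
  rewrite [RHS](bigID (fun m => tree_weight m g != 0)) /= [X in _ + X]big1 ?addr0 //.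
  by move=> m /andP[_ /negbNE/eqP].
have [|||x [xP xZ xx]] := greedy_disjoint (fun m => tree_weight_ge0 m g) light_weight_support
    (Z := g @: [set: option 'I_k * 'I_r]) (l := l) (c := k.+1).
- exact: cap_ge0.
- by move=> m; rewrite (leq_trans (leq_imset_card _ _)) // card_option card_ord.
- rewrite sumP; apply: le_lt_trans total; rewrite ler_wpM2r ?cap_ge0 //.
  by rewrite ler_nat leq_add2r (leq_trans (leq_card_imsetT _)) // card_prod card_option !card_ord.
have in_support j u : inner (x j) u \in support (x j) by apply: imset_f.
have edges j : (forall i, e (x j).1 ((x j).2 i)) /\ forall u i, e (inner (x j) u) (g (u, i)).
  by have /andP[_] := xP j; apply: tree_weight_neq0.
exists g, (fun j => inner (x j)); split=> // [j u j' u' E|j u a E|j u i|j i].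
- have jj' : j = j'.
    apply/eqP/negPn/negP => /xx; rewrite disjoint_subset => /subsetP/(_ _ (in_support j u)).
    by rewrite inE E in_support.
  split=> //; move: E; rewrite -jj'; apply: inner_inj; last by have [] := edges j.
  by have /andP[/and4P[/injectiveP]] := xP j.
- have := xZ j; rewrite disjoint_subset => /subsetP/(_ _ (in_support j u)).
  by rewrite inE E imset_f.
- by have [_ ->] := edges j.
- by have [-> _] := edges j.
Qed.
End FixedRoots.

Lemma mass_light_half :
  (8 * k)%:R * heavy_volume heavy <= volume -> (4 * (k ^ 2 + (k.+1 * r) ^ 2) <= d)%N ->
  volume / 2 <= mass (fun c : skeleton * _ => light heavy c.1 c.2).
Proof.
move=> few_heavy d_big; apply: le_trans (mass_light_ge k heavy).
have noninj_small : ((k ^ 2)%:R + ((k.+1 * r) ^ 2)%:R) / d%:R <= 4^-1 :> R.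
  by rewrite ler_pdivrMr ?ltr0n // -natrD; move: d_big; rewrite -(ler_nat R) natrM; lra.
have volume_ge0 : 0 <= volume by apply: le_trans volume_ge; rewrite ler0n.
have := ler_wpM2r volume_ge0 noninj_small; move: few_heavy; rewrite !natrM; lra.
Qed.

Lemma light_embedding : irreflexive e ->
  (8 * k)%:R * heavy_volume heavy <= volume -> (4 * (k ^ 2 + (k.+1 * r) ^ 2) <= d)%N ->
  (2 * ((k.+1 * r + l * k.+1) * (k.+1 * L ^ k)) * #|V| ^ (k.+1 * r)
     < #|V| * d ^ tree_size k r)%N ->
  blowup_embedding e k r l.
Proof.
move=> e_irr few_heavy d_big d_large.
pose B := (k.+1 * r + l * k.+1)%:R * (k.+1%:R * vertex_cap).
have B_ge0 : 0 <= B by rewrite mulr_ge0 ?ler0n // mulr_ge0 ?ler0n ?vertex_cap_ge0.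
suff [g _ B_lt] : exists2 g : {ffun option 'I_k * 'I_r -> V}, true
    & B < \sum_(m | light heavy m g) tree_weight m g.
  apply: (@light_embedding_at g) => //; apply/injectiveP.
  apply: contraTT B_lt => /negPf g_ninj; rewrite -leNgt big_pred0 // => m.
  by rewrite /light g_ninj andbF.
apply: ltr_sum_exists; rewrite sumr_const card_ffun card_prod card_option !card_ord -mulr_natl.
rewrite (exchange_big_dep xpredT) //= -(mass_pair (light heavy)).
apply: lt_le_trans (mass_light_half few_heavy d_big).
apply: lt_le_trans (_ : (#|V| * d)%:R / 2 <= _); last by rewrite ler_pM2r ?invr_gt0 ?volume_ge.
have D_gt0 : 0 < d%:R ^+ tree_size k r :> R by rewrite exprn_gt0 ?ltr0n.
rewrite /B vertex_capE ltr_pdivlMr ?ltr0n //.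
move: d_large; rewrite -(ltr_nat R) !natrM !natrX -(ltr_pM2l (_ : 0 < d%:R :> R)) ?ltr0n //.
set W := _ ^+ (_ * _); set D := d%:R ^+ tree_size k r in D_gt0 *; set Lk := L%:R ^+ k.
rewrite -(ltr_pM2r (_ : 0 < D^-1)) ?invr_gt0 //.
rewrite [d%:R * (_ * D)]mulrA mulfK ?gt_eqF // [#|V|%:R * d%:R]mulrC.
by move=> d_lt; apply: etrans d_lt; congr (_ < _); ring.
Qed.
End LightStars.

Section HeavyStars.
Hypotheses (r_gt0 : (0 < r)%N) (L_big : (2 * r ^ 2 <= L)%N).

Definition common_neighbours (S : rtuple) : {set V} := [set v | [forall j, e (S j) v]].
Definition root_weight (S : rtuple) : R := \prod_j (degree (S j) ^+ r)^-1.
Definition heavy_pairs (S0 : rtuple) : nat :=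
  \sum_(x in common_neighbours S0)
     #|[set S in ffun_on (mem (common_neighbours S0)) | heavy x S]|.

(* Both masses count complete bipartite graphs between an [r]-tuple [S0], weighted by [root_weight],
   and [r + 1] further vertices; summing over [S0] first gives powers of the codegrees. *)
Definition heavy_mass : R :=
  \sum_(S0 : rtuple | injectiveb S0) root_weight S0 * (heavy_pairs S0)%:R.
Definition total_mass : R := \sum_S0 root_weight S0 * #|common_neighbours S0|%:R ^+ r.+1.

Lemma root_weight_gt0 S0 : 0 < root_weight S0.
Proof. by apply: prodr_gt0 => j _; rewrite invr_gt0 exprn_gt0 ?degree_gt0. Qed.

Lemma root_weight_le S0 : root_weight S0 <= (d%:R ^+ r)^-1 ^+ r.
Proof.
rewrite -[X in _ <= _ ^+ X]card_ord -prodr_const; apply: ler_prod => j _.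
rewrite invr_ge0 exprn_ge0 ?ler0n //= lef_pV2 ?posrE ?exprn_gt0 ?degree_gt0 ?ltr0n //.
by apply: lerXn2r; rewrite ?nnegrE ?ler0n ?degree_ge.
Qed.

Lemma heavy_pairs_le S0 : (heavy_pairs S0 <= #|common_neighbours S0| ^ r.+1)%N.
Proof.
rewrite expnS -sum_nat_const; apply: leq_sum => x _.
rewrite -[r in (_ ^ r)%N]card_ord -card_ffun_on -[leqRHS]cardsE; apply: subset_leq_card.
by apply/subsetP => S; rewrite !inE => /andP[].
Qed.

Lemma prod_codegree_term (S0 : rtuple) x S :
  \prod_j codegree_term (S0 j) x S = root_weight S0
    * ((x \in common_neighbours S0) && (S \in ffun_on (mem (common_neighbours S0))))%:R.
Proof.
have termE j : codegree_term (S0 j) x S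
    = (degree (S0 j) ^+ r)^-1 * (e (S0 j) x && [forall i, e (S0 j) (S i)])%:R.
  rewrite /codegree_term /steps /step big_split /= prodr_natb prodr_const card_ord exprVn.
  by rewrite mulrA mulrC /adj -mulnb natrM.
rewrite (eq_bigr _ (fun j _ => termE j)) big_split /= prodr_natb; congr (_ * (nat_of_bool _)%:R).
apply/forallP/andP => [adj_all|[]].
  split; first by rewrite inE; apply/forallP => j; case/andP: (adj_all j).
  apply/ffun_onP => i; rewrite inE; apply/forallP => j.
  by case/andP: (adj_all j) => _ /forallP.
rewrite inE => /forallP x_common /ffun_onP S_common j; rewrite x_common /=.
by apply/forallP => i; have := S_common i; rewrite inE => /forallP.
Qed.

Lemma sum_prod_codegree_term (S0 : rtuple) (F : V -> rtuple -> R) :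
  \sum_x \sum_S F x S * \prod_j codegree_term (S0 j) x S
    = root_weight S0 * \sum_(x in common_neighbours S0)
        \sum_(S in ffun_on (mem (common_neighbours S0))) F x S.
Proof.
rewrite [X in _ * X]sumr_indicator mulr_sumr; apply: eq_bigr => x _.
rewrite [X in _ * (_ * X)]sumr_indicator !mulr_sumr; apply: eq_bigr => S _.
by rewrite prod_codegree_term -mulnb natrM; ring.
Qed.

Lemma codegree_expE x S : codegree x S ^+ r = \sum_(S0 : rtuple)
  \prod_j codegree_term (S0 j) x S.
Proof. by rewrite -(bigA_distr_bigA (fun _ y => codegree_term y x S)) prodr_const card_ord. Qed.

Let expr_r (x : R) : x ^+ r = x * x ^+ r.-1. Proof. by rewrite -exprS prednK. Qed.

Lemma heavy_codegree_le x S : heavy x S ->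
  codegree x S ^+ r
    <= 2 * \sum_(S0 : rtuple | injectiveb S0) \prod_j codegree_term (S0 j) x S.
Proof.
move=> x_heavy; rewrite codegree_expE [leLHS](bigID (fun S0 : rtuple => injectiveb S0)) /=.
set inj := \sum_(_ | _) _; set noninj := \sum_(_ | ~~ _) _.
suff : noninj <= codegree x S ^+ r / 2.
  rewrite codegree_expE [X in X / 2](bigID (fun S0 : rtuple => injectiveb S0)) /=.
  by rewrite -/inj -/noninj; lra.
have := @sum_prod_noninjective R 'I_r V (fun _ y => codegree_term y x S) (d%:R ^+ r)^-1
  (codegree x S ^+ r.-1) _ _ _ _.
rewrite card_ord => noninj_le; apply: le_trans (noninj_le _ _ _ _) _.
- by move=> _ v; apply: codegree_term_ge0.
- by move=> _ v; apply: codegree_term_le.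
- by rewrite invr_ge0 ltW.
- by move=> j; rewrite prodr_const_neq card_ord.
rewrite [codegree x S ^+ r]expr_r mulrA [leRHS]mulrAC ler_wpM2r ?exprn_ge0 ?codegree_ge0 //.
apply: le_trans (_ : threshold / 2 <= _); last by rewrite ler_wpM2r ?invr_ge0 ?ler0n.
rewrite /threshold mulrAC ler_wpM2r ?invr_ge0 ?(ltW dr_gt0) //.
by move: L_big; rewrite -(ler_nat R) natrM; lra.
Qed.

Lemma heavy_massE : heavy_mass = \sum_x \sum_S (heavy x S)%:R
  * \sum_(S0 : rtuple | injectiveb S0) \prod_j codegree_term (S0 j) x S.
Proof.
under [RHS]eq_bigr => x _.
  under eq_bigr => S _ do rewrite mulr_sumr.
  rewrite exchange_big /=; over.
rewrite exchange_big /=; apply: eq_bigr => S0 _.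
rewrite sum_prod_codegree_term natr_sum; congr (_ * _); apply: eq_bigr => x _.
rewrite natr_card_set [RHS]sumr_indicator; apply: eq_bigr => S _.
by rewrite -mulnb natrM.
Qed.

Lemma total_massE : total_mass = \sum_x \sum_S codegree x S ^+ r.
Proof.
under [RHS]eq_bigr => x _.
  under eq_bigr => S _ do rewrite codegree_expE.
  rewrite exchange_big /=; over.
rewrite exchange_big /=; apply: eq_bigr => S0 _.
transitivity (root_weight S0 * \sum_(x in common_neighbours S0)
    \sum_(S : rtuple | S \in ffun_on (mem (common_neighbours S0))) 1).
  under eq_bigr => x _ do rewrite sumr_const card_ffun_on card_ord.
  by rewrite sumr_const -mulrnA exprS -natrX -natrM mulnC.
rewrite -(sum_prod_codegree_term S0 (fun _ _ => 1)).
by apply: eq_bigr => x _; apply: eq_bigr => S _; rewrite mul1r.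
Qed.

Section ManyHeavyStars.
Variable c : nat.
Hypothesis many_heavy : volume < c%:R * heavy_volume heavy.

Lemma threshold_heavy_volume_le : threshold ^+ r.-1 * heavy_volume heavy <= 2 * heavy_mass.
Proof.
rewrite heavy_massE !mulr_sumr; apply: ler_sum => x _; rewrite !mulr_sumr.
apply: ler_sum => S _; case x_heavy: (heavy x S); rewrite ?mul0r ?mulr0 // !mul1r.
apply: le_trans (heavy_codegree_le x_heavy); rewrite expr_r mulrC.
by rewrite ler_wpM2l ?codegree_ge0 // lerXn2r ?nnegrE ?threshold_ge0 ?codegree_ge0.
Qed.

Lemma threshold_volume_le : threshold ^+ r.-1 * volume <= c%:R * (2 * heavy_mass).
Proof.
have T_ge0 : 0 <= threshold ^+ r.-1 by rewrite exprn_ge0 ?threshold_ge0.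
apply: le_trans (ler_wpM2l T_ge0 (ltW many_heavy)) _.
by rewrite mulrCA ler_wpM2l ?ler0n ?threshold_heavy_volume_le.
Qed.

Lemma total_mass_le : total_mass <= (2 * c.+1)%:R * heavy_mass.
Proof.
apply: le_trans (_ : 2 * heavy_mass + threshold ^+ r.-1 * volume <= _); last first.
  have -> : (2 * c.+1)%:R * heavy_mass = 2 * heavy_mass + c%:R * (2 * heavy_mass).
    by rewrite natrM -addn1 natrD; ring.
  by rewrite lerD2l threshold_volume_le.
rewrite total_massE heavy_massE -sum_codegree !mulr_sumr -big_split /=; apply: ler_sum => x _.
rewrite !mulr_sumr -big_split /=; apply: ler_sum => S _.
have [x_heavy|] := boolP (heavy x S).
  apply: ler_wpDr; last by rewrite mul1r heavy_codegree_le.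
  by rewrite mulr_ge0 ?exprn_ge0 ?threshold_ge0 ?codegree_ge0.
rewrite -ltNge => /ltW x_light; rewrite mul0r mulr0 add0r expr_r mulrC.
by rewrite ler_wpM2r ?codegree_ge0 // lerXn2r ?nnegrE ?threshold_ge0 ?codegree_ge0.
Qed.

Lemma heavy_mass_gt (n : nat) : (4 * c * n ^ r.+1 * #|V| ^ r < #|V| * d ^ r.+1)%N ->
  2 * ((#|V| ^ r)%:R * ((d%:R ^+ r)^-1 ^+ r * n%:R ^+ r.+1)) < heavy_mass.
Proof.
move=> n_small; set small := (#|V| ^ r)%:R * _; rewrite ltNge; apply/negP => heavy_mass_small.
have : (4 * c)%:R * small < threshold ^+ r.-1 * (#|V| * d)%:R.
  have D_gt0 : 0 < (d%:R ^+ r)^-1 ^+ r.-1 :> R by rewrite exprn_gt0 ?invr_gt0.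
  apply: lt_le_trans (_ : (d%:R ^+ r)^-1 ^+ r.-1 * (#|V| * d)%:R <= _); last first.
    rewrite ler_wpM2r ?ler0n // lerXn2r ?nnegrE ?threshold_ge0 ?invr_ge0 ?(ltW dr_gt0) //.
    rewrite /threshold ler_peMl ?invr_ge0 ?(ltW dr_gt0) // ler1n.
    by rewrite (leq_trans _ L_big) // muln_gt0 expn_gt0 r_gt0.
  move: n_small; rewrite -(ltr_nat R) /small (expr_r (_^-1)) [(d ^ _)%N]expnS !natrM !natrX.
  rewrite -(ltr_pM2l D_gt0) -(ltr_pM2r (_ : 0 < (d%:R ^+ r)^-1)) ?invr_gt0 //.
  rewrite [X in _ < X](_ : _ = (d%:R ^+ r)^-1 ^+ r.-1 * (#|V|%:R * d%:R)); last first.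
    by rewrite -!mulrA mulfV ?mulr1 // gt_eqF.
  by move=> d_lt; apply: etrans d_lt; congr (_ < _); ring.
rewrite ltNge => /negP; apply.
apply: le_trans (ler_wpM2l _ volume_ge) _; first by rewrite exprn_ge0 ?threshold_ge0.
apply: le_trans threshold_volume_le _.
have -> : (4 * c)%:R * small = c%:R * (2 * (2 * small)) by rewrite natrM; ring.
by rewrite ler_wpM2l ?ler0n // ler_wpM2l ?ler0n.
Qed.

Lemma dense_common_neighbours (n : nat) :
  (4 * c * n ^ r.+1 * #|V| ^ r < #|V| * d ^ r.+1)%N ->
  exists S0 : rtuple, [/\ injective S0, (n < #|common_neighbours S0|)%N
    & (#|common_neighbours S0| ^ r.+1 <= 4 * c.+1 * heavy_pairs S0)%N].
Proof.
move=> /heavy_mass_gt small_lt; pose size S0 := (#|common_neighbours S0| ^ r.+1)%N.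
have [S0 S0_inj] : exists2 S0 : rtuple, injectiveb S0
    & root_weight S0 * (4 * c.+1 * n ^ r.+1 + size S0)%:R
      < root_weight S0 * (4 * c.+1 * heavy_pairs S0)%:R.
  apply: ltr_sum_exists; under [ltRHS]eq_bigr => S0 _ do rewrite natrM mulrCA.
  rewrite -mulr_sumr -/heavy_mass.
  under eq_bigr => S0 _ do rewrite natrD mulrDr natrM mulrCA.
  rewrite big_split /= -mulr_sumr.
  have total_le : \sum_(S0 : rtuple | injectiveb S0) root_weight S0 * (size S0)%:R <= total_mass.
    rewrite /total_mass; under [leRHS]eq_bigr => S0 _ do rewrite -natrX.
    by apply: ler_sum_subset => // S0; rewrite mulr_ge0 ?ler0n ?(ltW (root_weight_gt0 _)).
  have small_le : \sum_(S0 : rtuple | injectiveb S0) root_weight S0 * (n ^ r.+1)%:R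
      <= (#|V| ^ r)%:R * ((d%:R ^+ r)^-1 ^+ r * n%:R ^+ r.+1).
    apply: le_trans (_ : \sum_(S0 : rtuple) (d%:R ^+ r)^-1 ^+ r * n%:R ^+ r.+1 <= _).
      apply: le_trans (ler_sum_subset (Q := predT) _ _) _ => // [S0|].
        by rewrite mulr_ge0 ?ler0n ?(ltW (root_weight_gt0 _)).
      by apply: ler_sum => S0 _; rewrite natrX ler_wpM2r ?exprn_ge0 ?ler0n ?root_weight_le.
    by rewrite sumr_const card_ffun card_ord mulr_natl.
  have {total_le} := le_trans total_le total_mass_le.
  have {small_le} : \sum_(S0 : rtuple | injectiveb S0) root_weight S0 * (n ^ r.+1)%:R
    < heavy_mass / 2 by lra.
  have c1_gt0 : 0 < c.+1%:R :> R by rewrite ltr0n.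
  rewrite -(ltr_pM2l c1_gt0) !natrM; lra.
rewrite ltr_pM2l ?root_weight_gt0 // ltr_nat => large; have pairs_le := heavy_pairs_le S0.
exists S0; split; first exact/injectiveP.
- rewrite -(ltn_exp2r _ _ (ltn0Sn r)) -(ltn_pmul2l (_ : 0 < 4 * c.+1)%N) //.
  apply: leq_ltn_trans (leq_addr _ _) (leq_trans large _).
  by rewrite leq_mul2l pairs_le orbT.
- by apply: leq_trans (ltnW large); apply: leq_addl.
Qed.
End ManyHeavyStars.

Lemma heavy_star_centres x (S : rtuple) : heavy x S -> (L <= #|star_centres e x S|)%N.
Proof.
move=> /le_trans x_heavy; rewrite -(ler_nat R) -(ler_pM2r (_ : 0 < (d%:R ^+ r)^-1)) ?invr_gt0 //.
apply: x_heavy; rewrite mulr_natl -sumr_const [leRHS]big_mkcond; apply: ler_sum => y _.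
rewrite inE /codegree_term /adj; case: (e y x) => /=; last by rewrite mul0r.
rewrite mul1r; case: ifPn => [_|]; first exact: steps_le.
by apply: contraR => nz; apply/forallP/steps_neq0; apply: contraNneq nz => ->.
Qed.

Lemma heavy_embedding (k l : nat) :
  irreflexive e -> (0 < k)%N -> (r + k * r + l + l * k <= L)%N ->
  volume < (8 * k)%:R * heavy_volume heavy ->
  (4 * (8 * k) * common_size k r l ^ r.+1 * #|V| ^ r < #|V| * d ^ r.+1)%N ->
  blowup_embedding e k r l.
Proof.
move=> e_irr k_gt0 L_ge many_heavy d_large.
have [S0 [S0_inj N_big dense]] := dense_common_neighbours many_heavy d_large.
have [||S [S_inj SN X_big]] := dense_relation _ dense N_big; rewrite ?muln_gt0 ?k_gt0 //.
apply: (common_neighbourhood_embedding e_sym e_irr S0_inj _ S_inj SN _ (ltnW X_big)).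
- by move=> j v; rewrite inE => /forallP.
- by apply/subsetP => x; rewrite inE => /andP[].
- move=> x i; rewrite inE => /andP[_ /forallP/(_ i)/heavy_star_centres/(leq_trans L_ge)].
  move=> /leq_trans; apply; apply: subset_leq_card; apply/subsetP => y; rewrite !inE.
  by case/andP=> -> /forallP eS; apply/forallP => j; have := eS j; rewrite ffunE.
Qed.
End HeavyStars.
End Threshold.
End RandomWalk.

(** * The upper bound *)

Lemma blowup_embedding_transfer (V W : finType) (e : rel V) (e' : rel W) (h : V -> W)
    (k r l : nat) :
  0 < r -> 0 < l -> symmetric e -> (forall x y, e x y -> e' (h x) (h y)) ->
  {in [pred x | neighbours e x != set0] &, injective h} ->
  blowup_embedding e k r l -> blowup_embedding e' k r l.
Proof.
move=> r_gt0 l_gt0 e_sym h_hom h_inj [g [X [g_inj X_inj Xg e_roots e_edges]]].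
have nonisolated x y : e x y -> x \in [pred x | neighbours e x != set0].
  by move=> exy; apply/set0Pn; exists y; rewrite inE.
have X_nonisolated j u := nonisolated _ _ (e_roots j u (Ordinal r_gt0)).
have g_nonisolated a : g a \in [pred x | neighbours e x != set0].
  by case: a => u i; apply: (nonisolated _ (X (Ordinal l_gt0) u)); rewrite e_sym.
exists (fun a => h (g a)), (fun j u => h (X j u)); split=> [a a'|j u j' u'|j u a|j u i|j i].
- by move/h_inj=> E; apply: g_inj; apply: E.
- by move/h_inj=> E; apply: X_inj; apply: E.
- by move/h_inj=> E; apply: (Xg j u a); apply: E.
- exact: h_hom.
- exact: h_hom.
Qed.

Definition heavy_threshold (k r l : nat) : nat := 2 * r ^ 2 + (r + k * r + l + l * k).

Definition noninjective_const (k r : nat) : nat := 4 * (k ^ 2 + (k.+1 * r) ^ 2).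
Definition light_const (k r l : nat) : nat :=
  2 * ((k.+1 * r + l * k.+1) * (k.+1 * heavy_threshold k r l ^ k)).
Definition heavy_const (k r l : nat) : nat := 4 * (8 * k) * common_size k r l ^ r.+1.

Definition upper_const (k r l : nat) : nat :=
  noninjective_const k r ^ tree_size k r + (light_const k r l).+1
    + (heavy_const k r l).+1 ^ tree_size k r.

Lemma upper_const_gt0 k r l : 0 < upper_const k r l.
Proof. by rewrite /upper_const addnAC addnS. Qed.

Lemma tree_size_gt0 k r : 0 < k -> 0 < tree_size k r.
Proof. by move=> k_gt0; rewrite addn_gt0 k_gt0 orbT. Qed.

Section MinDegree.
Variables (V : finType) (e : rel V) (d k r l : nat).
Hypotheses (e_sym : symmetric e) (e_irr : irreflexive e) (r_gt0 : 0 < r) (k_gt0 : 0 < k).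
Hypotheses (V_gt0 : 0 < #|V|) (deg_ge : forall x, d <= #|neighbours e x|).
Hypothesis d_large : upper_const k r l * #|V| ^ (k.+1 * r).-1 <= d ^ tree_size k r.

Let kr_gt0 : 0 < k.+1 * r. Proof. by rewrite muln_gt0. Qed.

Lemma noninjective_const_le : noninjective_const k r <= d.
Proof.
rewrite -(leq_exp2r _ _ (tree_size_gt0 r k_gt0)); apply: leq_trans d_large.
apply: leq_trans (leq_pmulr _ _); last by rewrite expn_gt0 V_gt0.
by rewrite /upper_const -addnA leq_addr.
Qed.

Lemma light_const_lt : light_const k r l * #|V| ^ (k.+1 * r) < #|V| * d ^ tree_size k r.
Proof.
rewrite -[X in _ ^ X](prednK kr_gt0) expnS mulnCA ltn_pmul2l //.
apply: leq_trans d_large; rewrite ltn_pmul2r ?expn_gt0 ?V_gt0 //.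
by rewrite /upper_const addnAC leq_addl.
Qed.

Lemma heavy_const_lt : heavy_const k r l * #|V| ^ r < #|V| * d ^ r.+1.
Proof.
have b_gt0 := tree_size_gt0 r k_gt0; have large := d_large; set b := tree_size k r in b_gt0 large *.
rewrite -[X in _ ^ X](prednK r_gt0) expnS mulnCA ltn_pmul2l // -(ltn_exp2r _ _ b_gt0).
rewrite -expnM [r.+1 * b]mulnC expnM.
apply: leq_trans (_ : (heavy_const k r l).+1 ^ b * (#|V| ^ r.-1) ^ b <= _).
  by rewrite -expnMn ltn_exp2r // ltn_pmul2r // expn_gt0 V_gt0.
apply: leq_trans (_ : ((heavy_const k r l).+1 ^ b * #|V| ^ (k.+1 * r).-1) ^ r.+1 <= _).
  rewrite expnMn; apply: leq_mul; first by rewrite expnS leq_pmulr // !expn_gt0.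
  rewrite -!expnM leq_pexp2l // /b /tree_size.
  by case: (r) r_gt0 => // r' _; rewrite mulSn /=; nia.
rewrite leq_exp2r //; apply: leq_trans large.
by rewrite leq_pmul2r ?expn_gt0 ?V_gt0 // /upper_const leq_addl.
Qed.

Lemma min_degree_embedding : blowup_embedding e k r l.
Proof.
have d_gt0 : 0 < d.
  by apply: leq_trans noninjective_const_le; rewrite muln_gt0 addn_gt0 expn_gt0 k_gt0.
pose L := heavy_threshold k r l.
have [few|many] := leP ((8 * k)%:R * heavy_volume rat e (@heavy rat V e d r L))%R (volume rat e).
  apply: (light_embedding e_sym d_gt0 deg_ge k_gt0 e_irr few noninjective_const_le).
  exact: light_const_lt.
apply: (heavy_embedding e_sym d_gt0 deg_ge r_gt0 (leq_addr _ _) e_irr k_gt0 (leq_addl _ _) many).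
exact: heavy_const_lt.
Qed.
End MinDegree.

Lemma exists_min_degree_subset (V : finType) (e : rel V) (d : nat) (A : {set V}) : symmetric e ->
  2 * d * #|A| < \sum_(x in A) #|neighbours e x :&: A| ->
  exists2 B : {set V}, B != set0 & forall x, x \in B -> d <= #|neighbours e x :&: B|.
Proof.
move=> e_sym; have [m] := ubnP #|A|; elim: m A => // m IH A A_lt dense.
have [/forall_inP deg_ge|] := boolP [forall x in A, d <= #|neighbours e x :&: A|].
  by exists A => //; apply: contraTneq dense => ->; rewrite big_set0.
rewrite negb_forall_in => /exists_inP[v vA]; rewrite -ltnNge => v_low.
have A_card : #|A| = #|A :\ v|.+1 by rewrite (cardsD1 v) vA.
apply: (IH (A :\ v)); first by rewrite -ltnS -A_card.
have deg_split x : #|neighbours e x :&: A| <= #|neighbours e x :&: (A :\ v)| + e x v.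
  rewrite (cardsD1 v) !inE vA andbT addnC leq_add2r; apply: subset_leq_card.
  by apply/subsetP => y; rewrite !inE => /and3P[-> -> ->].
have deg_v : \sum_(x in A :\ v) e x v <= #|neighbours e v :&: A|.
  rewrite -sum1_card [leqLHS]big_mkcond [leqRHS]big_mkcond; apply: leq_sum => x _.
  by rewrite !inE e_sym; case: (x \in A) (e v x) (x == v) => [] [] [].
have : \sum_(x in A) #|neighbours e x :&: A|
    <= #|neighbours e v :&: A| + \sum_(x in A :\ v) (#|neighbours e x :&: (A :\ v)| + e x v).
  by rewrite (big_setD1 v) //= leq_add2l; apply: leq_sum.
by move: dense; rewrite big_split /= A_card; lia.
Qed.

Lemma dense_embedding (V : finType) (e : rel V) (d k r l : nat) :
  symmetric e -> irreflexive e -> 0 < k -> 0 < r -> 0 < l ->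
  2 * d * #|V| < \sum_x #|neighbours e x| ->
  upper_const k r l * #|V| ^ (k.+1 * r).-1 <= d ^ tree_size k r ->
  blowup_embedding e k r l.
Proof.
move=> e_sym e_irr k_gt0 r_gt0 l_gt0 dense d_large.
have [|B B_neq0 B_deg] := @exists_min_degree_subset V e d setT e_sym.
  rewrite cardsT (eq_bigl predT) => [|x]; last by rewrite inE.
  by under eq_bigr => x _ do rewrite setIT.
pose W : finType := {x | x \in B}; pose e' (x y : W) := e (val x) (val y).
have W_card : #|W| = #|B| by rewrite card_sig; apply: eq_card => x; rewrite inE.
apply: (blowup_embedding_transfer (e := e') (h := val)) => //.
- by move=> x y; apply: e_sym.
- by move=> x y _ _; apply: val_inj.
apply: (@min_degree_embedding _ _ d) => // [x y|x||x|].
- exact: e_sym.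
- exact: e_irr.
- by rewrite W_card card_gt0.
- apply: leq_trans (B_deg _ (valP x)) _; rewrite -(card_imset _ val_inj).
  apply: subset_leq_card; apply/subsetP => y; rewrite !inE => /andP[exy yB].
  by apply/imsetP; exists (Sub y yB); rewrite ?inE ?SubK.
- by apply: leq_trans d_large; rewrite leq_mul2l leq_wexp2r ?orbT // W_card max_card.
Qed.

Definition graph_rel (n : nat) (g : {ffun 'I_n * 'I_n -> bool}) : rel 'I_n := fun x y => g (x, y).

Lemma simple_graphP (n : nat) (g : {ffun 'I_n * 'I_n -> bool}) :
  reflect (irreflexive (graph_rel g) /\ symmetric (graph_rel g)) (simple_graph g).
Proof.
apply: (iffP andP) => -[].
  move=> /forallP g_irr /forallP g_sym; split=> [x|x y]; first exact/negbTE/g_irr.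
  by have /forallP/(_ y)/eqP := g_sym x.
move=> g_irr g_sym; split; apply/forallP => x; first by rewrite -/(graph_rel g x x) g_irr.
by apply/forallP => y; rewrite -/(graph_rel g x y) g_sym.
Qed.

Lemma sum_neighbours_card (V : finType) (e : rel V) :
  \sum_x #|neighbours e x| = #|[set p : V * V | e p.1 p.2]|.
Proof.
rewrite -sum1dep_card -(pair_big_dep xpredT e (fun _ _ => 1)) /=.
by apply: eq_bigr => x _; rewrite sum1dep_card.
Qed.

Lemma sum_neighbours_nedges (n : nat) (g : {ffun 'I_n * 'I_n -> bool}) : simple_graph g ->
  \sum_x #|neighbours (graph_rel g) x| = 2 * nedges g.
Proof.
case/simple_graphP=> g_irr g_sym; rewrite sum_neighbours_card.
pose swap (p : 'I_n * 'I_n) := (p.2, p.1).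
have swap_inj : injective swap by case=> a b [c d] [-> ->].
rewrite -(cardsID [set p : 'I_n * 'I_n | p.1 < p.2]) mul2n -addnn /nedges.
congr (_ + _); first by apply: eq_card => -[x y]; rewrite !inE.
rewrite -[RHS](card_imset _ swap_inj); apply: eq_card => -[x y]; rewrite !inE /=.
apply/andP/imsetP => [[xy gxy]|[[a b]]].
  exists (y, x) => //; rewrite inE /= -/(graph_rel g y x) g_sym gxy /=.
  rewrite -leqNgt leq_eqVlt in xy; case/orP: xy => // /eqP/val_inj E.
  by rewrite E g_irr in gxy.
rewrite inE /= => /andP[gab ab] [-> ->]; rewrite g_sym [graph_rel g a b]gab.
by rewrite -leqNgt ltnW.
Qed.

Lemma nedges_upper (n k r l : nat) (g : {ffun 'I_n * 'I_n -> bool}) :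
  0 < k -> 0 < r -> 0 < l -> simple_graph g -> ~ blowup_embedding (graph_rel g) k r l ->
  nedges g ^ tree_size k r
    <= (4 ^ tree_size k r * upper_const k r l) * n ^ (2 * tree_size k r - k.+1).
Proof.
move=> k_gt0 r_gt0 l_gt0 g_simple; apply: contra_notT; rewrite -ltnNge => many.
have deg_sum := sum_neighbours_nedges g_simple; case/simple_graphP: g_simple => g_irr g_sym.
have b_gt0 := tree_size_gt0 r k_gt0; have C_gt0 := upper_const_gt0 k r l.
have exponent : 2 * tree_size k r - k.+1 = tree_size k r + (k.+1 * r).-1.
  by move: r_gt0; rewrite /tree_size; case: (r) => // r' _; nia.
move: many; rewrite exponent; set b := tree_size k r in b_gt0 *; set m := nedges g in deg_sum *.
move=> many; have n_gt0 : 0 < n.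
  rewrite lt0n; apply: contraTneq many => n0; rewrite [m](_ : _ = 0) ?exp0n //.
  by apply: eq_card0 => -[x y]; have := ltn_ord x; rewrite {2}n0.
have m_ge : 2 * n <= m.
  rewrite leqNgt; apply: contraTN many => /ltnW m_le; rewrite -leqNgt.
  apply: leq_trans (_ : (2 * n) ^ b <= _); first by rewrite leq_exp2r.
  rewrite expnMn; apply: leq_mul; last by rewrite leq_pexp2l ?leq_addr.
  by apply: leq_trans (leq_pmulr _ C_gt0); rewrite leq_exp2r.
pose d := m %/ (2 * n).
have m_lt : m < 4 * n * d.
  have d_gt0 : 0 < d by rewrite divn_gt0 ?muln_gt0.
  apply: leq_trans (_ : d.+1 * (2 * n) <= _); first by rewrite ltn_ceil // muln_gt0.
  by rewrite -mulnA [n * d]mulnC (mulnA 4) [d.+1 * _]mulnA leq_mul2r; lia.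
apply: (@dense_embedding _ _ d) => //.
  have := leq_divM m (2 * n); rewrite deg_sum card_ord -/d; lia.
rewrite card_ord -/b -(leq_pmul2r (_ : 0 < (4 * n) ^ b)) ?expn_gt0 ?muln_gt0 ?n_gt0 //.
apply: leq_trans (_ : m ^ b <= _); last by rewrite -expnMn mulnC leq_exp2r // ltnW.
by apply: leq_trans (ltnW many); rewrite expnD expnMn; apply: eq_leq; ring.
Qed.

(** * Polynomial functions *)

Section PolynomialFunctions.
Variable F : fieldType.
Notation R := {poly F}.
Local Open Scope ring_scope.

(* Points have coordinates in [F[X]]: the value and the derivative along [v] of a polynomial at [p]
   are its coefficients of [1] and ['X] at [along p v]. *)
Definition along (I : finType) (p v : I -> F) (i : I) : R := (p i)%:P + (v i)%:P * 'X.

Definition peval (I : finType) (E : nat) (c : {ffun {ffun I -> 'I_E.+1} -> F}) (y : I -> R) : R :=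
  \sum_a (c a)%:P * \prod_i y i ^+ a i.

Definition polyfun (I : finType) (E : nat) (P : (I -> R) -> R) : Prop :=
  exists c : {ffun {ffun I -> 'I_E.+1} -> F}, forall y, P y = peval c y.

Lemma eq_along (I : finType) (p p' v v' : I -> F) : p =1 p' -> v =1 v' -> along p v =1 along p' v'.
Proof. by move=> pp' vv' i; rewrite /along pp' vv'. Qed.

Lemma along_subC (I : finType) (p v : I -> F) i : along p v i - (p i)%:P = (v i)%:P * 'X.
Proof. by rewrite /along addrAC subrr add0r. Qed.

Lemma coef0_along (I : finType) (p v : I -> F) i : (along p v i)`_0 = p i.
Proof. by rewrite coefD coefC coefCM coefX mulr0 addr0. Qed.

Lemma eq_peval (I : finType) E (c : {ffun {ffun I -> 'I_E.+1} -> F}) (y z : I -> R) :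
  y =1 z -> peval c y = peval c z.
Proof. by move=> yz; apply: eq_bigr => a _; congr (_ * _); apply: eq_bigr => i _; rewrite yz. Qed.

Lemma pevalD (I : finType) E (c c' : {ffun {ffun I -> 'I_E.+1} -> F}) (y : I -> R) :
  peval (c + c') y = peval c y + peval c' y.
Proof. by rewrite /peval -big_split; apply: eq_bigr => a _; rewrite ffunE polyCD mulrDl. Qed.

Section Closure.
Variable I : finType.
Implicit Types P Q : (I -> R) -> R.

Lemma eq_polyfun E P Q : P =1 Q -> polyfun E P -> polyfun E Q.
Proof. by move=> PQ [c Pc]; exists c => y; rewrite -PQ. Qed.

Lemma polyfun_monomial E (a : I -> nat) : (forall i, a i <= E)%N ->
  polyfun E (fun y => \prod_i y i ^+ a i).
Proof.
move=> aE; pose b : {ffun I -> 'I_E.+1} := [ffun i => inord (a i)].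
exists [ffun x => (x == b)%:R] => y; rewrite /peval.
under [RHS]eq_bigr => x _ do rewrite ffunE mulrC polyC_natr.
rewrite (sumr_delta (fun x : {ffun I -> 'I_E.+1} => \prod_i y i ^+ x i)).
by apply: eq_bigr => i _; rewrite ffunE inordK // ltnS.
Qed.

Lemma polyfunZ E (u : F) P : polyfun E P -> polyfun E (fun y => u%:P * P y).
Proof.
case=> c Pc; exists [ffun x => u * c x] => y; rewrite Pc mulr_sumr.
by apply: eq_bigr => x _; rewrite ffunE polyCM mulrA.
Qed.

Lemma polyfun0 E : polyfun E (fun _ : I -> R => 0).
Proof. by exists [ffun=> 0] => y; rewrite /peval big1 // => x _; rewrite ffunE mul0r. Qed.

Lemma polyfunD E P Q : polyfun E P -> polyfun E Q -> polyfun E (fun y => P y + Q y).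
Proof. by case=> c Pc [c' Qc]; exists (c + c') => y; rewrite Pc Qc pevalD. Qed.

Lemma polyfun_sum E (J : finType) (P : J -> (I -> R) -> R) :
  (forall j, polyfun E (P j)) -> polyfun E (fun y => \sum_j P j y).
Proof.
move=> Pj; elim: (index_enum J) => [|j s IH].
  by apply: eq_polyfun (polyfun0 E) => y; rewrite big_nil.
by apply: eq_polyfun (polyfunD (Pj j) IH) => y; rewrite big_cons.
Qed.

Lemma polyfun_le E E' P : (E <= E')%N -> polyfun E P -> polyfun E' P.
Proof.
move=> EE' [c Pc]; apply: (@eq_polyfun _ (peval c)) => [y|]; first by rewrite Pc.
apply: polyfun_sum => a; apply: polyfunZ; apply: polyfun_monomial => i.
by rewrite (leq_trans _ EE') // -ltnS.
Qed.

Lemma polyfunM E E' P Q : polyfun E P -> polyfun E' Q -> polyfun (E + E') (fun y => P y * Q y).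
Proof.
case=> c Pc [c' Qc].
apply: (@eq_polyfun _ (fun y => \sum_a \sum_b (c a * c' b)%:P * \prod_i y i ^+ (a i + b i))).
  move=> y; rewrite Pc Qc /peval mulr_suml; apply: eq_bigr => a _; rewrite mulr_sumr.
  apply: eq_bigr => b _; rewrite polyCM mulrACA -big_split /=; congr (_ * _).
  by apply: eq_bigr => i _; rewrite exprD.
apply: polyfun_sum => a; apply: polyfun_sum => b; apply: polyfunZ; apply: polyfun_monomial => i.
by rewrite leq_add // -ltnS.
Qed.

Lemma polyfunC E (u : F) : polyfun E (fun _ : I -> R => u%:P).
Proof.
apply: eq_polyfun (polyfunZ u (@polyfun_monomial E (fun=> 0%N) _)) => // y.
by rewrite big1 ?mulr1.
Qed.

Lemma polyfun_var E i : (0 < E)%N -> polyfun E (fun y : I -> R => y i).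
Proof.
move=> E_gt0; apply: eq_polyfun (@polyfun_monomial E (fun j => (j == i) : nat) _) => [y|j].
  by rewrite (bigD1 i) //= eqxx big1 ?mulr1 // => j /negPf ->.
by rewrite (leq_trans (leq_b1 _)).
Qed.

Lemma polyfun_var_subC E i (u : F) : (0 < E)%N -> polyfun E (fun y : I -> R => y i - u%:P).
Proof.
move=> E_gt0; apply: eq_polyfun (polyfunD (polyfun_var i E_gt0) (polyfunC E (- u))) => y.
by rewrite polyCN.
Qed.

Lemma polyfunX E n P : polyfun E P -> polyfun (n * E) (fun y => P y ^+ n).
Proof.
move=> Pp; elim: n => [|n IH]; first exact: (polyfunC _ 1).
by apply: eq_polyfun (polyfunM Pp IH) => y; rewrite exprS.
Qed.

Lemma polyfun_prod E (J : finType) (A : pred J) (P : J -> (I -> R) -> R) :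
  (forall j, polyfun E (P j)) -> polyfun (#|J| * E) (fun y => \prod_(j | A j) P j y).
Proof.
move=> Pj; rewrite cardT enumT /index_enum; elim: (Finite.enum J) => [|j s IH].
  by apply: eq_polyfun (polyfunC _ 1) => y; rewrite big_nil.
case Aj: (A j).
  by apply: eq_polyfun (polyfunM (Pj j) IH) => y; rewrite big_cons Aj.
by apply: eq_polyfun (polyfun_le (leq_addl _ _) IH) => y; rewrite big_cons Aj.
Qed.

End Closure.

Lemma polyfun_comp (I J : finType) E D (P : (J -> R) -> R) (y : J -> (I -> R) -> R) :
  polyfun E P -> (forall j, polyfun D (y j)) ->
  polyfun (#|J| * (E * D)) (fun z => P (fun j => y j z)).
Proof.
case=> c Pc yj; apply: (@eq_polyfun _ _ (fun z => peval c (fun j => y j z))) => [z|].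
  by rewrite Pc.
apply: polyfun_sum => a; apply: polyfunZ; apply: polyfun_prod => j.
by apply: polyfun_le (polyfunX (a j) (yj j)); rewrite leq_mul2r -ltnS ltn_ord orbT.
Qed.

Lemma polyfun_dependent (I M : finType) (E : nat) (Psi : M -> (I -> R) -> R) :
  (forall m, polyfun E (Psi m)) -> (E.+1 ^ #|I| < #|M|)%N ->
  exists2 g : M -> F, exists m, g m != 0 & forall y, \sum_m (g m)%:P * Psi m y = 0.
Proof.
move=> Psi_poly card_lt; have [c cP] := fin_all_exists Psi_poly.
pose C := \matrix_(i < #|M|, j < #|{ffun I -> 'I_E.+1}|) c (enum_val i) (enum_val j).
have [u uC /rV0Pn[i ui_neq0]] : exists2 u : 'rV_#|M|, u *m C = 0 & u != 0.
  have /rowV0Pn[u /sub_kermxP uC u_neq0] : kermx C != 0.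
    rewrite -mxrank_eq0 mxrank_ker -lt0n subn_gt0; apply: leq_ltn_trans (rank_leq_col _) _.
    by rewrite card_ffun card_ord.
  by exists u.
exists (fun m => u 0 (enum_rank m)) => [|y]; first by exists (enum_val i); rewrite enum_valK.
under eq_bigr => m _ do rewrite cP /peval mulr_sumr.
rewrite exchange_big big1 // => a _.
under eq_bigr => m _ do rewrite mulrA -polyCM.
rewrite -mulr_suml -rmorph_sum /=.
suff -> : \sum_m u 0 (enum_rank m) * c m a = 0 by rewrite mul0r.
have /matrixP/(_ 0 (enum_rank a)) := uC; rewrite mxE [RHS]mxE => uCa; rewrite -[RHS]uCa.
rewrite (reindex_onto enum_val enum_rank) => [|k _]; last exact: enum_rankK.
apply: eq_big => [j|j _]; first by rewrite enum_valK eqxx.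
by rewrite enum_valK mxE enum_rankK.
Qed.

(* The coefficient of [X^n] of a polynomial relation whose terms all have order at least [n]. *)
Lemma lowest_order_relation (K : finType) (A n : nat) (y : R) (phi : K -> R)
    (g : 'I_A.+1 * {ffun K -> 'I_A.+1} -> F) :
  (forall k, (phi k)`_0 = 0) ->
  (forall j (a : {ffun K -> 'I_A.+1}), (\sum_k a k < n)%N -> g (j, a) = 0) ->
  \sum_(m : 'I_A.+1 * {ffun K -> 'I_A.+1}) (g m)%:P * (y ^+ m.1 * \prod_k phi k ^+ m.2 k) = 0 ->
  \sum_(a : {ffun K -> 'I_A.+1} | (\sum_k a k == n)%N)
    (\sum_j g (j, a) * y`_0 ^+ j) * \prod_k (phi k)`_1 ^+ a k = 0.
Proof.
move=> phi0 g_low /polyP/(_ n); rewrite coef0 coef_sum => relation; rewrite -[RHS]relation.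
pose B k := drop_poly 1 (phi k).
have phiE k : phi k = B k * 'X.
  rewrite -[LHS](poly_take_drop 1) expr1 (_ : take_poly 1 (phi k) = 0) ?add0r //.
  by apply/polyP => -[|i]; rewrite coef_take_poly coef0 //= phi0.
rewrite big_mkcond; under eq_bigr => a _.
  rewrite (_ : (if _ then _ else _) = \sum_j if (\sum_k a k == n)%N
    then g (j, a) * y`_0 ^+ j * \prod_k (phi k)`_1 ^+ a k else 0).
    over.
  by case: eqP => _; rewrite ?mulr_suml // big1.
rewrite exchange_big pair_big /=; apply: eq_bigr => -[j a] _ /=.
have -> : \prod_k phi k ^+ a k = \prod_k B k ^+ a k * 'X^(\sum_k a k).
  by rewrite expr_sum -big_split /=; apply: eq_bigr => k _; rewrite phiE exprMn.
rewrite coefCM mulrA coefMXn; case: (ltngtP (\sum_k a k)%N n) => [a_low|_|->].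
- by rewrite g_low ?mul0r.
- by rewrite mulr0.
rewrite subnn -!horner_coef0 hornerM horner_prod horner_exp -!mulrA; congr (_ * (_ * _)).
by apply: eq_bigr => k _; rewrite horner_exp horner_coef0 coef_drop_poly.
Qed.

Definition bezout_bound (m D : nat) : nat := (1 + m * D) ^ m.

Section System.
Variables (I K : finType) (D : nat) (Phi : K -> (I -> R) -> R).
Let A := bezout_bound #|I| D.

Definition zero_at (P : I -> F) : Prop := forall k v, (Phi k (along P v))`_0 = 0.
Definition nonsingular_at (P : I -> F) : Prop :=
  forall w : K -> F, exists v, forall k, (Phi k (along P v))`_1 = w k.

Lemma coordinate_relation (i : I) : #|K| = #|I| -> (forall k, polyfun D (Phi k)) ->
  exists2 g : 'I_A.+1 * {ffun K -> 'I_A.+1} -> F, exists m, g m != 0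
    & forall y, \sum_m (g m)%:P * (y i ^+ m.1 * \prod_k Phi k y ^+ m.2 k) = 0.
Proof.
move=> card_K Phi_poly.
apply: (@polyfun_dependent I _ (A + #|K| * (A * D))) => [[j a]|] /=.
  apply: (polyfunM (P := fun y => y i ^+ j)).
    by apply: polyfun_le (polyfunX j (polyfun_var i (ltn0Sn 0))); rewrite muln1 -ltnS.
  apply: polyfun_prod => k; apply: polyfun_le (polyfunX (a k) (Phi_poly k)).
  by rewrite leq_mul2r -ltnS ltn_ord orbT.
rewrite card_prod card_ffun !card_ord card_K.
apply: leq_ltn_trans (_ : (A.+1 * (1 + #|I| * D)) ^ #|I| < _)%N; first by apply: leq_wexp2r; nia.
by rewrite expnMn -/(bezout_bound _ _) -/A mulnC ltn_pmul2r ?expn_gt0.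
Qed.
End System.
End PolynomialFunctions.

(** * Counting nonsingular zeros *)

Lemma digits_lt (q n : nat) (f : 'I_n -> nat) :
  (forall i, f i < q) -> \sum_i f i * q ^ i < q ^ n.
Proof.
elim: n f => [|n IH] f f_lt; first by rewrite big_ord0 expn0.
rewrite big_ord_recr /= expnS.
have := IH (fun i => f (widen_ord (leqnSn n) i)) (fun i => f_lt _).
by have := f_lt ord_max; set S := (\sum_(i < n) _)%N; nia.
Qed.

Lemma digits_inj (q n : nat) (f g : 'I_n -> nat) :
  (forall i, f i < q) -> (forall i, g i < q) ->
  \sum_i f i * q ^ i = \sum_i g i * q ^ i -> f =1 g.
Proof.
elim: n f g => [|n IH] f g f_lt g_lt; first by move=> _ [].
pose low (h : 'I_n.+1 -> nat) (i : 'I_n) := h (widen_ord (leqnSn n) i).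
have low_lt h : (forall i, h i < q) -> \sum_i low h i * q ^ i < q ^ n.
  by move=> h_lt; apply: digits_lt => i; apply: h_lt.
rewrite !big_ord_recr /= -/(low f) -/(low g).
have := low_lt f f_lt; have := low_lt g g_lt.
have := IH (low f) (low g) (fun i => f_lt _) (fun i => g_lt _); rewrite /low.
set Sf := \sum_(i < n) f _ * _; set Sg := \sum_(i < n) g _ * _ => low_eq Sg_lt Sf_lt E.
have top_eq : f ord_max = g ord_max by nia.
have {}low_eq : low f =1 low g by apply: low_eq; move: E; rewrite top_eq; lia.
move=> i; have [j ->|->] := unliftP ord_max i; last exact: top_eq.
have := low_eq j; rewrite /low; congr (f _ = g _); apply: val_inj;
  by rewrite /= /bump leqNgt ltn_ord.
Qed.

Section NonsingularZeros.
Variable F : finFieldType.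
Notation R := {poly F}.
Local Open Scope ring_scope.

(* Kronecker substitution [w_k := z ^ (A.+1 ^ k)] sends distinct monomials to distinct powers of
   [z]. *)
Lemma vanishing_coefs (K : finType) (A : nat) (H : {ffun K -> 'I_A.+1} -> F) :
  (A.+1 ^ #|K| <= #|F|)%N ->
  (forall w : K -> F, \sum_a H a * \prod_k w k ^+ a k = 0) -> forall a, H a = 0.
Proof.
move=> F_big H_vanish.
pose code (a : {ffun K -> 'I_A.+1}) := (\sum_(i < #|K|) a (enum_val i) * A.+1 ^ i)%N.
have code_lt a : (code a < A.+1 ^ #|K|)%N by apply: digits_lt => i; apply: ltn_ord.
have code_inj : injective code.
  move=> a b E; apply/ffunP => k; apply: val_inj; rewrite -(enum_rankK k) /=.
  by apply: (@digits_inj A.+1 _ (fun i => a (enum_val i)) (fun i => b (enum_val i)) _ _ E) => i;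
    apply: ltn_ord.
pose p : R := \sum_a H a *: 'X^(code a).
have coef_code a : p`_(code a) = H a.
  rewrite coef_sum -[RHS](sumr_delta H); apply: eq_bigr => b _.
  by rewrite coefZ coefXn (inj_eq code_inj) eq_sym.
suff p0 : p = 0 by move=> a; rewrite -coef_code p0 coef0.
have p_size : (size p <= #|F|)%N.
  apply: leq_trans F_big; apply: leq_trans (size_sum _ _ _) _; apply/bigmax_leqP => a _.
  by apply: leq_trans (size_scale_leq _ _) _; rewrite size_polyXn.
apply: (@roots_geq_poly_eq0 _ p (enum F)); [|exact: enum_uniq|by rewrite -cardE].
apply/allP => z _; apply/rootP.
rewrite horner_sum -[RHS](H_vanish (fun k => z ^+ (A.+1 ^ enum_rank k))).
apply: eq_bigr => a _; rewrite hornerZ hornerXn; congr (_ * _).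
rewrite /code expr_sum [RHS](reindex_onto enum_val enum_rank) => [|k _]; last exact: enum_rankK.
apply: eq_big => [i|i _]; first by rewrite enum_valK eqxx.
by rewrite enum_valK -exprM mulnC.
Qed.

Lemma card_coordinate_roots (I : finType) (n : nat) (G : I -> R) (Z : {set {ffun I -> F}}) :
  (forall i, G i != 0) -> (forall i, size (G i) <= n.+1)%N ->
  (forall i P, P \in Z -> root (G i) (P i)) -> (#|Z| <= n ^ #|I|)%N.
Proof.
move=> G_neq0 G_size G_root; pose S i := [set x : F | root (G i) x].
have S_card i : (#|S i| <= n)%N.
  rewrite -ltnS; apply: leq_trans (G_size i); rewrite cardE.
  apply: max_poly_roots (G_neq0 i) _ (enum_uniq _).
  by apply/allP => x; rewrite mem_enum inE.
apply: leq_trans (_ : #|family S| <= _)%N.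
  apply: subset_leq_card; apply/subsetP => P PZ; apply/familyP => i.
  by rewrite inE G_root.
rewrite card_family foldrE big_map big_enum /= -prod_nat_const.
by apply: leq_prod => i _.
Qed.

Section System.
Variables (I K : finType) (D : nat) (Phi : K -> (I -> R) -> R).
Let A := bezout_bound #|I| D.
Hypotheses (card_K : #|K| = #|I|) (Phi_poly : forall k, polyfun D (Phi k)).

(* The terms of lowest order in the [Phi k] of an algebraic relation between a coordinate and the
   [Phi k] must vanish at a nonsingular zero, where the [Phi k] have arbitrary linear parts. *)
Lemma nonsingular_zero_coordinate (i : I) : (A.+1 ^ #|I| <= #|F|)%N ->
  exists2 G : R, G != 0 & (size G <= A.+1)%N
    /\ forall P, zero_at Phi P -> nonsingular_at Phi P -> root G (P i).
Proof.
move=> F_big; have [g [m0 gm0] relation] := coordinate_relation i card_K Phi_poly.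
pose order (m : 'I_A.+1 * {ffun K -> 'I_A.+1}) := (\sum_k m.2 k)%N.
have [m gm m_min] := @arg_minnP _ m0 (fun m => g m != 0) order gm0.
pose G a : R := \poly_(j < A.+1) g (inord j, a).
have hornerG a x : (G a).[x] = \sum_(j < A.+1) g (j, a) * x ^+ j.
  by rewrite horner_poly; apply: eq_bigr => j _; rewrite inord_val.
exists (G m.2); last split; last first.
- move=> P P_zero P_nonsingular; apply/rootP.
  pose H (a : {ffun K -> 'I_A.+1}) := if (\sum_k a k == order m)%N then (G a).[P i] else 0.
  suff : H m.2 = 0 by rewrite /H eqxx.
  apply: vanishing_coefs; rewrite ?card_K // => w; have [v vw] := P_nonsingular w.
  have := relation (along P v); move/lowest_order_relation => /(_ (order m)) lowest.
  rewrite -[RHS]lowest => [|k|j a]; last 2 first.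
  + exact: P_zero.
  + by apply: contraTeq => /m_min; rewrite -leqNgt.
  rewrite [RHS]big_mkcond; apply: eq_bigr => a _; rewrite /H.
  case: eqP => _; last by rewrite mul0r.
  by rewrite hornerG coef0_along; congr (_ * _); apply: eq_bigr => k _; rewrite vw.
- exact: size_poly.
- apply: contraNneq gm => /polyP/(_ m.1); rewrite coef0 coef_poly ltn_ord inord_val.
  by rewrite -surjective_pairing => ->.
Qed.

Lemma card_nonsingular_zeros (Z : {set {ffun I -> F}}) : (A.+1 ^ #|I| <= #|F|)%N ->
  (forall P : {ffun I -> F}, P \in Z -> zero_at Phi P /\ nonsingular_at Phi P) ->
  (#|Z| <= A ^ #|I|)%N.
Proof.
move=> F_big Z_zeros; have [G G_neq0 GP] := fin_all_exists2 (nonsingular_zero_coordinate ^~ F_big).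
apply: (card_coordinate_roots (G := G)) => // [i|i P /Z_zeros[]]; first by case: (GP i).
by case: (GP i) => _; apply.
Qed.
End System.
End NonsingularZeros.

(** * Values and gradients at prescribed points *)

Section Jets.
Variables (F : fieldType) (J : finType).
Notation R := {poly F}.
Local Open Scope ring_scope.

Definition has_gradient (P : (J -> R) -> R) : Prop :=
  exists (f : (J -> F) -> F) (g : (J -> F) -> J -> F), forall p v,
    (P (along p v))`_0 = f p /\ (P (along p v))`_1 = \sum_k v k * g p k.

Lemma eq_has_gradient P Q : P =1 Q -> has_gradient P -> has_gradient Q.
Proof. by move=> PQ [f [g PP]]; exists f, g => p v; rewrite -PQ. Qed.

Lemma has_gradientC u : has_gradient (fun=> u%:P).
Proof.
exists (fun=> u), (fun _ _ => 0) => p v; rewrite !coefC; split=> //.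
by rewrite big1 // => k _; rewrite mulr0.
Qed.

Lemma has_gradient_var i : has_gradient (fun y => y i).
Proof.
exists (fun p => p i), (fun _ k => (k == i)%:R) => p v; rewrite coef0_along sumr_delta.
by rewrite coefD coefC coefCM coefX mulr1 add0r.
Qed.

Lemma has_gradientM P Q : has_gradient P -> has_gradient Q -> has_gradient (fun y => P y * Q y).
Proof.
move=> [f [g PP]] [f' [g' QQ]].
exists (fun p => f p * f' p), (fun p k => f p * g' p k + g p k * f' p) => p v.
have [P0 P1] := PP p v; have [Q0 Q1] := QQ p v.
split; first by rewrite coefM big_ord1 P0 Q0.
rewrite coefM big_ord_recl big_ord1 /= P0 P1 Q0 Q1 mulr_sumr mulr_suml -big_split /=.
by apply: eq_bigr => k _; ring.
Qed.

Lemma has_gradientD P Q : has_gradient P -> has_gradient Q -> has_gradient (fun y => P y + Q y).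
Proof.
move=> [f [g PP]] [f' [g' QQ]].
exists (fun p => f p + f' p), (fun p k => g p k + g' p k) => p v.
have [P0 P1] := PP p v; have [Q0 Q1] := QQ p v.
rewrite !coefD P0 P1 Q0 Q1 -big_split /=; split=> //.
by apply: eq_bigr => k _; ring.
Qed.

Lemma polyfun_has_gradient E P : polyfun E P -> has_gradient P.
Proof.
have gradX n i : has_gradient (fun y => y i ^+ n).
  elim: n => [|n IH]; first exact: (has_gradientC 1).
  by apply: eq_has_gradient (has_gradientM (has_gradient_var i) IH) => y; rewrite exprS.
have grad_monomial (a : {ffun J -> 'I_E.+1}) : has_gradient (fun y => \prod_i y i ^+ a i).
  elim: (index_enum _) => [|i s IH].
    by apply: eq_has_gradient (has_gradientC 1) => y; rewrite big_nil.
  by apply: eq_has_gradient (has_gradientM (gradX (a i) i) IH) => y; rewrite big_cons.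
case=> c Pc; apply: (@eq_has_gradient (peval c)) => [y|]; first by rewrite Pc.
rewrite /peval; elim: (index_enum _) => [|a s IH].
  by apply: eq_has_gradient (has_gradientC 0) => y; rewrite big_nil.
have := has_gradientD (has_gradientM (has_gradientC (c a)) (grad_monomial a)) IH.
by apply: eq_has_gradient => y; rewrite big_cons.
Qed.

Definition unit_dir (k i : J) : F := (i == k)%:R.

Definition jet E (c : {ffun {ffun J -> 'I_E.+1} -> F}) (p : J -> F) (o : option J) : F :=
  if o is Some k then (peval c (along p (unit_dir k)))`_1 else (peval c (along p (fun=> 0)))`_0.

Section JetsOfDegree.
Variable E : nat.
Notation coefs := {ffun {ffun J -> 'I_E.+1} -> F}.

Lemma peval_has_gradient (c : coefs) : has_gradient (peval c).
Proof. by apply: polyfun_has_gradient; exists c. Qed.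

Lemma peval_coef0 (c : coefs) p v : (peval c (along p v))`_0 = jet c p None.
Proof. by have [f [g gradP]] := peval_has_gradient c; rewrite /jet !(proj1 (gradP _ _)). Qed.

Lemma peval_coef1 (c : coefs) p v : (peval c (along p v))`_1 = \sum_k v k * jet c p (Some k).
Proof.
have [f [g gradP]] := peval_has_gradient c; rewrite (proj2 (gradP _ _)).
apply: eq_bigr => k _; congr (_ * _); rewrite /jet (proj2 (gradP _ _)) -[LHS](sumr_delta (g p)).
by apply: eq_bigr => i _; rewrite mulrC.
Qed.

Lemma jetD (c c' : coefs) p o : jet (c + c') p o = jet c p o + jet c' p o.
Proof. by case: o => [k|]; rewrite /jet pevalD coefD. Qed.

Section Interpolation.
Variables (Q : finType) (pts : Q -> {ffun J -> F}).
Hypothesis pts_inj : injective pts.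

Lemma exists_bump (q : Q) : exists2 B : (J -> R) -> R, polyfun (#|Q| * 2) B &
  (forall q' v, q' != q -> exists T, B (along (pts q') v) = T * 'X^2)
  /\ forall v, (B (along (pts q) v))`_0 != 0.
Proof.
pose sep q' := [pick k | pts q k != pts q' k].
pose factor q' (y : J -> R) : R := if sep q' is Some k then (y k - (pts q' k)%:P) ^+ 2 else 1.
have sepP q' : q' != q -> exists2 k, sep q' = Some k & pts q k != pts q' k.
  move=> qq'; rewrite /sep; case: pickP => [k k_sep|same]; first by exists k.
  case/eqP: qq'; apply/pts_inj/ffunP => k; apply/eqP.
  by have /negbT := same k; rewrite negbK eq_sym.
exists (fun y => \prod_(q' | q' != q) factor q' y); last split=> [q' v qq'|v].
- apply: polyfun_prod => q'; rewrite /factor; case: (sep q') => [k|].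
    exact: (polyfunX 2 (polyfun_var_subC k _ (ltn0Sn 0))).
  exact: (polyfunC J _ 1).
- rewrite (bigD1 q') //= /factor; have [k -> _] := sepP _ qq'.
  by rewrite along_subC exprMn mulrAC; eexists.
- rewrite -horner_coef0 horner_prod; apply/prodf_neq0 => q' qq'.
  rewrite /factor; have [k -> pts_neq] := sepP _ qq'.
  by rewrite horner_exp hornerD hornerN hornerC horner_coef0 coef0_along expf_neq0 ?subr_eq0.
Qed.

Lemma exists_local_interpolation (q : Q) (dl : option J -> F) :
  exists2 P : (J -> R) -> R, polyfun (#|Q| * 2).+1 P & [/\
    forall v, (P (along (pts q) v))`_0 = dl None,
    forall v, (P (along (pts q) v))`_1 = \sum_k v k * dl (Some k)
    & forall q' v i, q' != q -> (i < 2)%N -> (P (along (pts q') v))`_i = 0].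
Proof.
have [B B_poly [B_far B_neq0]] := exists_bump q.
have [b0 [b1 gradB]] := polyfun_has_gradient B_poly.
have [{}gradB b0_neq0] : (forall v, (B (along (pts q) v))`_0 = b0 (pts q) /\
    (B (along (pts q) v))`_1 = \sum_k v k * b1 (pts q) k) /\ b0 (pts q) != 0.
  by split=> //; rewrite -(proj1 (gradB _ (fun=> 0))).
move: {b0 b1} (b0 _) (b1 _) => b0 b1 in gradB b0_neq0 *.
pose u := dl None / b0; pose a k := (dl (Some k) - u * b1 k) / b0.
pose affine (y : J -> R) := u%:P + \sum_k (a k)%:P * (y k - (pts q k)%:P).
have affine_along v : affine (along (pts q) v) = u%:P + (\sum_k v k * a k)%:P * 'X.
  rewrite /affine rmorph_sum mulr_suml /=; congr (_ + _); apply: eq_bigr => k _.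
  by rewrite along_subC mulrA -polyCM [a k * _]mulrC.
exists (fun y => B y * affine y); last split=> [v|v|q' v i qq' i_lt2].
- rewrite -addn1; apply: polyfunM => //; apply: polyfunD; first exact: polyfunC.
  by apply: polyfun_sum => k; apply/polyfunZ/polyfun_var_subC.
- have [B0 _] := gradB v.
  rewrite affine_along coefM big_ord1 B0 /= coefD coefC coefCM coefX mulr0 addr0 /u.
  by rewrite mulrC divfK.
- have [B0 B1] := gradB v.
  rewrite affine_along coefM big_ord_recl big_ord1 /= !coefD !coefC !coefCM !coefX B0 B1 /=.
  rewrite mulr0 addr0 mulr1 add0r mulr_sumr mulr_suml -big_split; apply: eq_bigr => k _ /=.
  by rewrite /a; field.
- by have [T ->] := B_far q' v qq'; rewrite mulrAC coefMXn i_lt2.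
Qed.

Lemma exists_interpolation (dl : Q -> option J -> F) : (#|Q| * 2 < E)%N ->
  exists c : coefs, forall q o, jet c (pts q) o = dl q o.
Proof.
move=> Q_small.
have [P P_poly PP] := fin_all_exists2 (fun q => exists_local_interpolation q (dl q)).
have [c cP] : polyfun E (fun y => \sum_q P q y).
  by apply: polyfun_sum => q; apply: polyfun_le (P_poly q).
have coef_c q v i : (i < 2)%N -> (peval c (along (pts q) v))`_i = (P q (along (pts q) v))`_i.
  move=> i_lt2; rewrite -cP coef_sum (bigD1 q) //= big1 ?addr0 // => q' qq'.
  by have [_ _] := PP q'; apply; rewrite // eq_sym.
exists c => q [k|]; rewrite /jet coef_c //; have [val grad _] := PP q; last exact: val.
rewrite grad -[RHS](sumr_delta (fun k => dl q (Some k))).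
by apply: eq_bigr => i _; rewrite mulrC.
Qed.

End Interpolation.
End JetsOfDegree.
End Jets.

HB.instance Definition _ (aT : finType) (rT : finZmodType) := Finite.on {ffun aT -> rT}.

Lemma card_preim_additive (A B : finZmodType) (f : A -> B) (S : {set B}) :
  {morph f : x y / (x + y)%R} -> (forall y, exists x, f x = y) ->
  #|[set x | f x \in S]| * #|B| = #|S| * #|A|.
Proof.
move=> fD f_surj; pose fibre y := [set x | f x == y].
have fibre_card y y' : #|fibre y| = #|fibre y'|.
  suff fibre_le z z' : #|fibre z| <= #|fibre z'| by apply/eqP; rewrite eqn_leq !fibre_le.
  have [x0 fx0] := f_surj (z' - z)%R; rewrite -(card_imset _ (addIr x0)).
  apply/subset_leq_card/subsetP => _ /imsetP[x + ->]; rewrite !inE fD fx0 => /eqP ->.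
  by rewrite addrC subrK.
have preim_card (T : {set B}) : #|[set x | f x \in T]| = #|T| * #|fibre 0%R|.
  rewrite -sum_nat_const -sum1dep_card (partition_big f (mem T)) //=; apply: eq_bigr => y yT.
  rewrite -(fibre_card y) -sum1dep_card; apply: eq_bigl => x.
  by case: eqP => [->|]; rewrite ?yT ?andbF.
have -> : #|A| = #|[set x | f x \in [set: B]]|.
  by rewrite -cardsT; apply: eq_card => x; rewrite !inE.
by rewrite !preim_card cardsT -mulnA [#|B| * _]mulnC.
Qed.

Lemma card_jets (F : finFieldType) (J Q W : finType) (E : nat) (pts : Q -> {ffun J -> F})
    (S : {set {ffun Q * W -> {ffun option J -> F}}})
    (polys := {ffun W -> {ffun {ffun J -> 'I_E.+1} -> F}}) :
  injective pts -> #|Q| * 2 < E ->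
  #|[set c : polys | [ffun qw => [ffun o => jet (c qw.2) (pts qw.1) o]] \in S]|
    * #|{: {ffun Q * W -> {ffun option J -> F}}}| = #|S| * #|{: polys}|.
Proof.
move=> pts_inj Q_small.
pose f (c : polys) : {ffun Q * W -> {ffun option J -> F}} :=
  [ffun qw => [ffun o => jet (c qw.2) (pts qw.1) o]].
apply: (card_preim_additive (f := f)) => [c c'|dl].
  by apply/ffunP => -[q w]; apply/ffunP => o; rewrite !ffunE jetD.
have [c cP] := fin_all_exists (fun w => exists_interpolation pts_inj (fun q => dl (q, w)) Q_small).
by exists [ffun w => c w]; apply/ffunP => -[q w]; apply/ffunP => o; rewrite !ffunE cP.
Qed.

(** * The system of equations of a copy of the tree *)

Section TreeSystem.
Variables (F : finFieldType) (k r : nat).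

Definition coord : finType := ('I_r * option 'I_k + 'I_k)%type.
Definition tree_edge : finType := (option 'I_k * 'I_r + 'I_k)%type.
Definition end_coord : finType := (bool * coord)%type.
Definition unknown : finType := (option 'I_k * coord)%type.
Definition equation : finType := (tree_edge * option 'I_k)%type.

Lemma card_coord : #|coord| = tree_size k r.
Proof. by rewrite card_sum card_prod card_option !card_ord mulnC. Qed.

(* The satellite [Some i] absorbs all but one of the equations of the edge joining it to the
   centre. *)
Definition unknown_of (kp : equation) : unknown :=
  match kp with
  | (inl (u, j), w) => (u, inl (j, w))
  | (inr i, None) => (None, inr i)
  | (inr i, Some i') => (Some i, inr i')
  end.

Definition equation_of (i : unknown) : equation :=
  match i with
  | (u, inl (j, w)) => (inl (u, j), w)
  | (None, inr i) => (inr i, None)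
  | (Some i, inr i') => (inr i, Some i')
  end.

Lemma unknown_ofK : cancel unknown_of equation_of.
Proof. by case=> [[[[u|] j]|i] [w|]]. Qed.

Lemma equation_ofK : cancel equation_of unknown_of.
Proof. by case=> [[u|] [[j w]|i]]. Qed.

Lemma card_equation : #|equation| = #|unknown|.
Proof. exact: bij_eq_card (Bijective unknown_ofK equation_ofK). Qed.

Section FixedSides.
Variable side : option 'I_k -> bool.
Local Open Scope ring_scope.

Definition edge_coord (S : Type) (g : option 'I_k * 'I_r -> coord -> S) (y : unknown -> S)
    (ep : tree_edge) (x : end_coord) : S :=
  match ep with
  | inl a => if x.1 == side a.1 then y (a.1, x.2) else g a x.2
  | inr i => if x.1 == side None then y (None, x.2) else y (Some i, x.2)
  end.

Definition edge_dir (v : unknown -> F) : tree_edge -> end_coord -> F := edge_coord (fun _ _ => 0) v.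

Lemma edge_coord_along (g : option 'I_k * 'I_r -> coord -> F) (P v : unknown -> F) ep :
  edge_coord (fun a x => (g a x)%:P) (along P v) ep =1 along (edge_coord g P ep) (edge_dir v ep).
Proof.
case: ep => [a|i] x; rewrite /along /edge_dir /=; case: ifP => _ //.
by rewrite mul0r addr0.
Qed.

Notation gradients := {ffun equation -> {ffun end_coord -> F}}.

Definition jacobian (G : gradients) (v : unknown -> F) (kp : equation) : F :=
  \sum_x edge_dir v kp.1 x * G kp x.

Definition jacobian_onto (G : gradients) : bool :=
  [forall w : {ffun equation -> F}, [exists v : {ffun unknown -> F},
    [forall kp, jacobian G v kp == w kp]]].

Definition delta (i i' : unknown) : F := (i' == i)%:R.

Lemma jacobianE (G : gradients) (v : unknown -> F) kp :
  jacobian G v kp = \sum_i v i * jacobian G (delta i) kp.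
Proof.
rewrite /jacobian; under [RHS]eq_bigr => i _ do rewrite mulr_sumr.
rewrite exchange_big; apply: eq_bigr => x _ /=.
under eq_bigr => i _ do rewrite mulrA; rewrite -mulr_suml; congr (_ * _).
have expand j : v j = \sum_i v i * delta i j.
  by rewrite -[LHS](sumr_delta v); apply: eq_bigr => i _; rewrite /delta eq_sym.
case: kp => -[a|i] w; rewrite /edge_dir /=; case: ifP => _ //.
by rewrite big1 // => i _; rewrite mulr0.
Qed.

Definition jacobian_mx (G : gradients) : 'M[F]_#|unknown| :=
  \matrix_(i, j) jacobian G (delta (enum_val i)) (equation_of (enum_val j)).

Lemma jacobian_onto_unitmx (G : gradients) : jacobian_mx G \in unitmx -> jacobian_onto G.
Proof.
move=> G_unit; apply/forallP => w; apply/existsP.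
pose wr : 'rV[F]_#|unknown| := \row_j w (equation_of (enum_val j)).
pose v := wr *m invmx (jacobian_mx G).
exists [ffun i => v 0 (enum_rank i)]; apply/forallP => kp; apply/eqP.
have /matrixP/(_ 0 (enum_rank (unknown_of kp))) : v *m jacobian_mx G = wr by rewrite mulmxKV.
rewrite !mxE enum_rankK unknown_ofK => <-; rewrite jacobianE.
rewrite (reindex_onto enum_val enum_rank) => [|i _]; last exact: enum_rankK.
apply: eq_big => [j|j _]; first by rewrite enum_valK eqxx.
by rewrite [X in _ = _ * X]mxE ffunE enum_valK enum_rankK unknown_ofK.
Qed.

Definition unit_gradient (kp : equation) (x : end_coord) : F :=
  match kp with
  | (inl (u, j), w) => (x == (side u, inl (j, w)))%:R
  | (inr i, None) => (x == (side None, inr i))%:R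
  | (inr i, Some i') => (x == (~~ side None, inr i'))%:R
  end.

Definition shift_gradients (G : gradients) (z : F) : gradients :=
  [ffun kp => [ffun x => G kp x + z * unit_gradient kp x]].

Lemma jacobian_shift (G : gradients) z (v : unknown -> F) kp :
  jacobian (shift_gradients G z) v kp = jacobian G v kp + z * v (unknown_of kp).
Proof.
rewrite /jacobian; under eq_bigr => x _ do rewrite !ffunE mulrDr mulrCA.
rewrite big_split -mulr_sumr; congr (_ + z * _).
case: kp => -[[u j]|i] [i'|]; rewrite /unit_gradient sumr_delta /edge_dir /= ?eqxx //.
by case: (side None).
Qed.

Lemma jacobian_mx_shift (G : gradients) z :
  jacobian_mx (shift_gradients G z) = jacobian_mx G + z%:M.
Proof.
apply/matrixP => i j; rewrite !mxE jacobian_shift equation_ofK; congr (_ + _).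
by rewrite /delta (inj_eq enum_val_inj) eq_sym mulr_natr.
Qed.

Definition singular : {set gradients} := [set G | ~~ jacobian_onto G].

Lemma card_singular_shifts (G : gradients) :
  (#|[set z | shift_gradients G z \in singular]| <= #|unknown|)%N.
Proof.
have singular_root z : shift_gradients G z \in singular -> root (char_poly (jacobian_mx G)) (- z).
  rewrite inE; apply: contraR => not_root; apply: jacobian_onto_unitmx; rewrite jacobian_mx_shift.
  move: not_root; rewrite -eigenvalue_root_char /eigenvalue /eigenspace negbK.
  by rewrite raddfN opprK -row_free_unit -kermx_eq0.
rewrite -(card_imset _ (@oppr_inj F)) -ltnS -[X in (_ < X)%N](size_char_poly (jacobian_mx G)) cardE.
apply: max_poly_roots; last exact: enum_uniq.
  by rewrite monic_neq0 ?char_poly_monic.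
by apply/allP => z; rewrite mem_enum => /imsetP[z']; rewrite inE => /singular_root z'_root ->.
Qed.

(* Shifting the gradients by [z * unit_gradient] adds the scalar matrix [z] to the Jacobian, so only
   few shifts are singular; each shift permutes the gradients. *)
Lemma card_singular : (#|singular| * #|F| <= #|unknown| * #|{: gradients}|)%N.
Proof.
have shift_card z : #|[set G | shift_gradients G z \in singular]| = #|singular|.
  have inj : injective (fun G => shift_gradients G z).
    move=> G G' /ffunP E; apply/ffunP => kp; apply/ffunP => x.
    by have /ffunP/(_ x) := E kp; rewrite !ffunE => /addIr.
  rewrite -[LHS](card_imset _ inj); apply: eq_card => G.
  have [inv _ invK] := injF_bij inj.
  apply/imsetP/idP => [[G']|G_singular]; first by rewrite inE => G'_singular ->.
  by exists (inv G); rewrite ?invK // inE invK.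
have -> : (#|singular| * #|F| = \sum_z #|[set G | shift_gradients G z \in singular]|)%N.
  by under eq_bigr do rewrite shift_card; rewrite sum_nat_const mulnC.
rewrite exchange_sum_card mulnC -sum_nat_const; apply: leq_sum => G _.
exact: card_singular_shifts.
Qed.

Section Copies.
Variables (E n : nat) (g : option 'I_k * 'I_r -> coord -> F).
Notation coefs := {ffun {ffun end_coord -> 'I_E.+1} -> F}.
Notation polys := {ffun option 'I_k -> coefs}.

Definition system (c : polys) (kp : equation) (y : unknown -> {poly F}) : {poly F} :=
  peval (c kp.2) (edge_coord (fun a x => (g a x)%:P) y kp.1).

Definition edge_point (P : unknown -> F) (ep : tree_edge) : {ffun end_coord -> F} :=
  [ffun x => edge_coord g P ep x].

Definition gradients_at (c : polys) (P : unknown -> F) : gradients :=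
  [ffun kp => [ffun x => jet (c kp.2) (edge_point P kp.1) (Some x)]].

Definition is_copy (c : polys) (P : unknown -> F) : bool :=
  [forall kp : equation, jet (c kp.2) (edge_point P kp.1) None == 0].

Definition singular_copy (c : polys) (P : unknown -> F) : bool :=
  is_copy c P && (gradients_at c P \in singular).

Lemma system_along c kp P v :
  system c kp (along P v) = peval (c kp.2) (along (edge_point P kp.1) (edge_dir v kp.1)).
Proof.
by apply: eq_peval => x; rewrite edge_coord_along; apply: eq_along => // i; rewrite ffunE.
Qed.

Lemma is_copy_zero_at c P : is_copy c P -> zero_at (system c) P.
Proof. by move=> /forallP copy kp v; rewrite system_along peval_coef0; apply/eqP. Qed.

Lemma system_coef1 c kp P v : (system c kp (along P v))`_1 = jacobian (gradients_at c P) v kp.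
Proof. by rewrite system_along peval_coef1; apply: eq_bigr => x _; rewrite !ffunE. Qed.

Lemma nonsingular_at_system c P : gradients_at c P \notin singular -> nonsingular_at (system c) P.
Proof.
rewrite inE negbK => /forallP onto w; have /existsP[v /forallP vw] := onto [ffun kp => w kp].
by exists v => kp; rewrite system_coef1 (eqP (vw kp)) ffunE.
Qed.

Lemma system_polyfun c kp : polyfun (#|end_coord| * E) (system c kp).
Proof.
have edge_poly x :
    polyfun 1 (fun y : unknown -> {poly F} => edge_coord (fun a x => (g a x)%:P) y kp.1 x).
  case: kp => -[a|i] w /=.
    by case: (x.1 == side a.1); [apply: polyfun_var | apply: polyfunC].
  by case: (x.1 == side None); apply: polyfun_var.
have c_poly : polyfun E (peval (c kp.2)) by exists (c kp.2).
by have := polyfun_comp c_poly edge_poly; rewrite muln1.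
Qed.

Lemma card_nonsingular_copies c (Z : {set {ffun unknown -> F}})
    (A := bezout_bound #|unknown| (#|end_coord| * E)) : (A.+1 ^ #|unknown| <= #|F|)%N ->
  (forall P : {ffun unknown -> F}, P \in Z -> is_copy c P && (gradients_at c P \notin singular)) ->
  (#|Z| <= A ^ #|unknown|)%N.
Proof.
move=> F_big Z_copies; apply: (card_nonsingular_zeros card_equation (system_polyfun c) F_big).
by move=> P /Z_copies/andP[/is_copy_zero_at P_zero /nonsingular_at_system].
Qed.

Section PrescribedJets.
Notation jets := {ffun ('I_n * tree_edge) * option 'I_k -> {ffun option end_coord -> F}}.

Definition jets_gradients (dl : jets) (a : 'I_n) : gradients :=
  [ffun kp => [ffun x => dl ((a, kp.1), kp.2) (Some x)]].

Definition singular_jets : {set jets} :=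
  [set dl : jets | [forall q, dl q None == 0] && [forall a, jets_gradients dl a \in singular]].

Lemma card_singular_jets : (#|singular_jets| <= #|singular| ^ n)%N.
Proof.
rewrite -[n in (_ ^ n)%N]card_ord -card_ffun_on.
have inj : {in singular_jets &, injective (fun dl : jets => [ffun a => jets_gradients dl a])}.
  move=> dl dl'; rewrite !inE => /andP[/forallP val0 _] /andP[/forallP val0' _] /ffunP grad_eq.
  apply/ffunP => -[[a ep] w]; apply/ffunP => -[x|]; last by rewrite (eqP (val0 _)) (eqP (val0' _)).
  have := grad_eq a; rewrite !ffunE => /ffunP/(_ (ep, w)); rewrite !ffunE => /ffunP/(_ x).
  by rewrite !ffunE.
rewrite -(card_in_imset inj); apply: subset_leq_card; apply/subsetP => f /imsetP[dl].
by rewrite inE => /andP[_ /forallP dl_singular] ->; apply/ffun_onP => a; rewrite ffunE.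
Qed.

Lemma singular_jetsP (X : 'I_n -> {ffun unknown -> F}) (c : polys) :
  ([ffun qw : ('I_n * tree_edge) * option 'I_k =>
      [ffun o => jet (c qw.2) (edge_point (X qw.1.1) qw.1.2) o]] \in singular_jets)
  = [forall a, singular_copy c (X a)].
Proof.
set dl := [ffun _ => _].
have gradE a : jets_gradients dl a = gradients_at c (X a).
  by apply/ffunP => kp; apply/ffunP => x; rewrite !ffunE.
rewrite inE; apply/andP/forallP => [[/forallP val0 /forallP grad] a|copies].
  rewrite /singular_copy -gradE grad andbT; apply/forallP => -[ep w].
  by have := val0 ((a, ep), w); rewrite !ffunE.
split; apply/forallP => q; last by have /andP[_] := copies q; rewrite gradE.
by case: q => [[a ep] w]; have /andP[/forallP/(_ (ep, w))] := copies a; rewrite !ffunE.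
Qed.
End PrescribedJets.

Lemma card_all_singular (X : 'I_n -> {ffun unknown -> F}) :
  injective (fun q : 'I_n * tree_edge => edge_point (X q.1) q.2) -> (n * #|tree_edge| * 2 < E)%N ->
  (#|[set c : polys | [forall a, singular_copy c (X a)]]| * #|F| ^ (n * (#|equation| + 1))
     <= #|unknown| ^ n * #|{: polys}|)%N.
Proof.
move=> X_inj E_big.
have := card_jets (E := E) singular_jets X_inj; rewrite card_prod card_ord => /(_ E_big).
under eq_finset => c do rewrite singular_jetsP.
have -> : #|{: {ffun ('I_n * tree_edge) * option 'I_k -> {ffun option end_coord -> F}}}|
    = (#|F| ^ (n * #|equation|) * #|{: gradients}| ^ n)%N.
  rewrite !card_ffun card_option !card_prod card_ord -!expnM -expnD; congr (_ ^ _)%N.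
  ring.
set num := #|_| => num_eq; have gradients_gt0 : (0 < #|{: gradients}| ^ n)%N.
  by rewrite expn_gt0; apply/orP; left; apply/card_gt0P; exists [ffun=> [ffun=> 0]].
rewrite -(leq_pmul2r gradients_gt0).
apply: leq_trans (_ : #|singular_jets| * #|{: polys}| * #|F| ^ n <= _)%N.
  by rewrite -num_eq mulnDr muln1 expnD !mulnA mulnAC.
apply: leq_trans (_ : (#|singular| * #|F|) ^ n * #|{: polys}| <= _)%N.
  by rewrite expnMn mulnAC leq_mul2r leq_mul2r card_singular_jets !orbT.
by rewrite mulnAC leq_mul2r -expnMn (leq_wexp2r _ card_singular) orbT.
Qed.
End Copies.
End FixedSides.
End TreeSystem.

(** * The random algebraic graph *)

Lemma ltn_union_bound (q m p b c n B C : nat) : n = m * p + b.+1 -> 2 ^ p.+1 * c ^ n < q ->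
  0 < C -> B * q ^ n <= (2 * q ^ m) ^ p * c ^ n * C -> 2 * q ^ b * B < C.
Proof.
move=> nE q_big C_gt0 B_le; have q_gt0 : 0 < q by apply: leq_trans q_big.
rewrite -(ltn_pmul2r (_ : 0 < q ^ n)) ?expn_gt0 ?q_gt0 //.
apply: leq_ltn_trans (_ : 2 ^ p.+1 * c ^ n * q ^ (b + m * p) * C < _).
  rewrite -mulnA; apply: leq_trans (leq_mul (leqnn _) B_le) _.
  by rewrite expnMn -expnM expnD (expnS 2 p); apply: eq_leq; ring.
rewrite mulnC ltn_pmul2l // [X in _ < _ ^ X]nE addnS (expnS q) [m * p + b]addnC.
by rewrite ltn_pmul2r // expn_gt0 q_gt0.
Qed.

Section RandomGraph.
Variables (F : finFieldType) (k r : nat).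
Notation coord := (coord k r).
Notation tree_edge := (tree_edge k r).
Notation end_coord := (end_coord k r).
Notation unknown := (unknown k r).
Notation vertex := (bool * {ffun coord -> F})%type.

(* One more than the exponent of [#|F|] lost to the union bound over the roots and to the edge
   density. *)
Definition num_copies : nat := #|coord| * (k.+1 * r) + k.+2.
Definition random_degree : nat := (num_copies * #|tree_edge| * 2).+1.
Definition max_nonsingular : nat := bezout_bound #|unknown| (#|end_coord| * random_degree).
Definition max_copies : nat := max_nonsingular ^ #|unknown| + num_copies.
Definition singular_const : nat := 2 ^ (k.+1 * r).+1 * #|unknown| ^ num_copies.
Definition min_field : nat := (max_nonsingular.+1 ^ #|unknown| + singular_const).+1.

Notation coefs := {ffun {ffun end_coord -> 'I_random_degree.+1} -> F}.
Notation polys := {ffun option 'I_k -> coefs}.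

Local Open Scope ring_scope.

Definition common_zero (c : polys) (p : {ffun end_coord -> F}) : bool :=
  [forall w, jet (c w) p None == 0].
Definition pair_point (v v' : vertex) : {ffun end_coord -> F} :=
  [ffun x => if x.1 == v.1 then v.2 x.2 else v'.2 x.2].
Definition algebraic_graph (c : polys) : rel vertex :=
  fun v v' => (v.1 != v'.1) && common_zero c (pair_point v v').

Lemma pair_pointC v v' : v.1 != v'.1 -> pair_point v v' = pair_point v' v.
Proof.
move=> vv'; apply/ffunP => -[b x]; rewrite !ffunE /=.
by case: b vv' => /=; case: v.1; case: v'.1.
Qed.

Lemma pair_point_inj v v' u u' : v.1 != v'.1 -> u.1 != u'.1 ->
  pair_point v v' = pair_point u u' -> (v = u /\ v' = u') \/ (v = u' /\ v' = u).
Proof.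
wlog vu : u u' / v.1 = u.1.
  move=> oriented vv' uu'; have [|vu] := eqVneq v.1 u.1; first by move=> vu; apply: oriented.
  rewrite (pair_pointC uu') => /(oriented u' u _ vv') [||[-> ->]|[-> ->]]; try by [left | right].
    by move: vv' uu' vu; case: v.1; case: v'.1; case: u.1; case: u'.1.
  by rewrite eq_sym.
move=> vv' uu' /ffunP E; left.
have vu' : v'.1 = u'.1 by move: vv' uu' vu; case: v.1; case: v'.1; case: u.1; case: u'.1.
case: v v' u u' vv' uu' vu vu' E => [b x] [b' x'] [d y] [d' y'] /= bb' _ <- <- E.
split; congr (_, _); apply/ffunP => z.
  by have := E (b, z); rewrite !ffunE /= eqxx.
by have := E (b', z); rewrite !ffunE /= eq_sym (negPf bb').
Qed.

Lemma algebraic_graph_sym c : symmetric (algebraic_graph c).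
Proof.
move=> v v'; rewrite /algebraic_graph eq_sym; case: eqP => //= /eqP vv'.
by rewrite pair_pointC // eq_sym.
Qed.

Lemma algebraic_graph_irr c : irreflexive (algebraic_graph c).
Proof. by move=> v; rewrite /algebraic_graph eqxx. Qed.

Lemma card_common_zero c : (#|[set p | common_zero c p]|
  <= #|[set p : vertex * vertex | algebraic_graph c p.1 p.2]|)%N.
Proof.
pose h (p : {ffun end_coord -> F}) : vertex * vertex :=
  ((true, [ffun x => p (true, x)]), (false, [ffun x => p (false, x)])).
have hK : cancel h (fun vv' => pair_point vv'.1 vv'.2).
  by move=> p; apply/ffunP => -[[] x]; rewrite !ffunE.
rewrite -(card_imset _ (can_inj hK)); apply: subset_leq_card; apply/subsetP => _ /imsetP[p + ->].
by rewrite !inE /algebraic_graph hK.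
Qed.

Definition side (g : {ffun option 'I_k * 'I_r -> vertex}) (u : option 'I_k) : bool :=
  if [pick j : 'I_r] is Some j then ~~ (g (u, j)).1 else false.
Definition root_coord (g : {ffun option 'I_k * 'I_r -> vertex}) (a : option 'I_k * 'I_r) :
  coord -> F := (g a).2.

(* Roots together with [num_copies] candidate copies of the tree on them. *)
Definition configuration : finType :=
  ({ffun option 'I_k * 'I_r -> vertex} * {ffun 'I_num_copies -> {ffun unknown -> F}})%type.

Definition distinct_edges (x : configuration) : bool :=
  injectiveb (fun q : 'I_num_copies * tree_edge =>
    edge_point (side x.1) (root_coord x.1) (x.2 q.1) q.2).
Definition bad (c : polys) (x : configuration) : bool :=
  distinct_edges x && [forall a, singular_copy (side x.1) (root_coord x.1) c (x.2 a)].

Section EmbeddedBlowup.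
Variables (c : polys) (l : nat) (g0 : option 'I_k * 'I_r -> vertex).
Variable X : 'I_l -> option 'I_k -> vertex.
Hypotheses (r_gt0 : (0 < r)%N) (F_big : (max_nonsingular.+1 ^ #|unknown| <= #|F|)%N).
Hypotheses (l_big : (max_copies <= l)%N) (g0_inj : injective g0).
Hypothesis X_inj : forall j u j' u', X j u = X j' u' -> j = j' /\ u = u'.
Hypothesis X_neq_root : forall j u a, X j u <> g0 a.
Hypothesis root_edge : forall j u i, algebraic_graph c (X j u) (g0 (u, i)).
Hypothesis inner_edge : forall j i, algebraic_graph c (X j None) (X j (Some i)).

Let g : {ffun option 'I_k * 'I_r -> vertex} := [ffun a => g0 a].
Let copy j : {ffun unknown -> F} := [ffun i => (X j i.1).2 i.2].
Let edge_ends j (ep : tree_edge) : vertex * vertex :=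
  match ep with inl a => (X j a.1, g0 a) | inr i => (X j None, X j (Some i)) end.

Lemma side_embedded j u : (X j u).1 = side g u.
Proof.
rewrite /side; case: pickP => [i _|/(_ (Ordinal r_gt0)) //].
by have /andP[] := root_edge j u i; rewrite ffunE; case: (X j u).1; case: (g0 _).1.
Qed.

Lemma edge_ends_adjacent j ep : algebraic_graph c (edge_ends j ep).1 (edge_ends j ep).2.
Proof. by case: ep => [[u i]|i] /=. Qed.

Lemma edge_point_embedded j ep :
  edge_point (side g) (root_coord g) (copy j) ep = pair_point (edge_ends j ep).1 (edge_ends j ep).2.
Proof.
apply/ffunP => -[b x]; case: ep => [[u i]|i]; rewrite !ffunE /= side_embedded; case: ifP => _;
  by rewrite ?ffunE // /root_coord ffunE.
Qed.

Lemma copy_inj : injective copy.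
Proof.
move=> j j' E; have [] // := X_inj (_ : X j None = X j' None).
rewrite [X j None]surjective_pairing [X j' None]surjective_pairing !side_embedded.
by congr (_, _); apply/ffunP => x; have /ffunP/(_ (None, x)) := E; rewrite !ffunE.
Qed.

Lemma is_copy_embedded j : is_copy (side g) (root_coord g) c (copy j).
Proof.
apply/forallP => -[ep w] /=; rewrite edge_point_embedded.
by have /andP[_ /forallP/(_ w)] := edge_ends_adjacent j ep.
Qed.

Let singular_indices : {set 'I_l} := [set j | singular_copy (side g) (root_coord g) c (copy j)].

Lemma many_singular_embedded : (num_copies <= #|singular_indices|)%N.
Proof.
have few_nonsingular : (#|copy @: ~: singular_indices| <= max_nonsingular ^ #|unknown|)%N.
  apply: (card_nonsingular_copies (side := side g) (g := root_coord g) (c := c)) => //.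
  move=> P /imsetP[j]; rewrite in_setC in_set /singular_copy is_copy_embedded => nonsingular ->.
  by rewrite is_copy_embedded.
rewrite (card_imset _ copy_inj) in few_nonsingular.
rewrite -(leq_add2r #|~: singular_indices|) cardsC card_ord addnC.
by apply: leq_trans l_big; rewrite leq_add2r.
Qed.

Lemma edge_points_embedded_inj (n : nat) (sub : 'I_n -> 'I_l) : injective sub ->
  injective (fun q : 'I_n * tree_edge =>
    edge_point (side g) (root_coord g) (copy (sub q.1)) q.2).
Proof.
move=> sub_inj [a ep] [a' ep'] /=; rewrite !edge_point_embedded.
have /andP[ends_neq _] := edge_ends_adjacent (sub a) ep.
have /andP[ends_neq' _] := edge_ends_adjacent (sub a') ep'.
move/(pair_point_inj ends_neq ends_neq') => {ends_neq ends_neq'}.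
case: ep => [b|i]; case: ep' => [b'|i'] /=.
- by case=> [[/X_inj[/sub_inj -> _] /g0_inj -> //]|[/X_neq_root]].
- by case=> -[_ /esym/X_neq_root].
- by case=> -[E E']; [have := X_neq_root E' | have := X_neq_root E].
- by case=> -[/X_inj[/sub_inj -> E] /X_inj[_ E']] //; case: E' => ->.
Qed.

Lemma embedded_bad : exists x, bad c x.
Proof.
pose sub (a : 'I_num_copies) : 'I_l := enum_val (widen_ord many_singular_embedded a).
have sub_inj : injective sub.
  by move=> a a' /enum_val_inj E; apply: val_inj; have := congr1 val E.
exists (g, [ffun a => copy (sub a)]); apply/andP; split.
  apply/injectiveP => q q'; rewrite /= !ffunE; exact: edge_points_embedded_inj.
apply/forallP => a; rewrite /= ffunE.
by have := enum_valP (widen_ord many_singular_embedded a); rewrite in_set.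
Qed.
End EmbeddedBlowup.

Lemma blowup_bad (c : polys) l : (0 < r)%N -> (max_nonsingular.+1 ^ #|unknown| <= #|F|)%N ->
  (max_copies <= l)%N -> blowup_embedding (algebraic_graph c) k r l -> exists x, bad c x.
Proof.
move=> r_gt0 F_big l_big [g [X [g_inj X_inj Xg root_edge inner_edge]]].
exact: (embedded_bad r_gt0 F_big l_big g_inj X_inj Xg root_edge inner_edge).
Qed.

Lemma card_configuration : #|configuration|
  = ((2 * #|F| ^ #|coord|) ^ (k.+1 * r) * #|F| ^ (num_copies * #|unknown|))%N.
Proof.
by rewrite card_prod !card_ffun !card_prod card_bool card_ffun !card_option !card_ord -expnM
  [(num_copies * _)%N]mulnC.
Qed.

Let F_gt0 : (0 < #|F|)%N. Proof. by apply/card_gt0P; exists 0. Qed.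

Lemma sum_bad : ((\sum_c #|[set x | bad c x]|) * #|F| ^ num_copies <=
   (2 * #|F| ^ #|coord|) ^ (k.+1 * r) * #|unknown| ^ num_copies * #|{: polys}|)%N.
Proof.
rewrite exchange_sum_card -(leq_pmul2r (_ : 0 < #|F| ^ (num_copies * #|equation k r|)))%N;
  last by rewrite expn_gt0 F_gt0.
rewrite -mulnA -expnD.
apply: leq_trans (_ : \sum_(x : configuration) (#|unknown| ^ num_copies * #|{: polys}|) <= _)%N.
  rewrite big_distrl /=; apply: leq_sum => x _.
  have [/injectiveP x_inj|x_ninj] := boolP (distinct_edges x); last first.
    by rewrite (_ : finset _ = set0) ?cards0 //; apply/setP => c; rewrite !inE /bad (negPf x_ninj).
  apply: leq_trans (card_all_singular x_inj (leqnn _)).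
  rewrite mulnDr muln1 addnC leq_mul2r; apply/orP; right; apply: subset_leq_card.
  by apply/subsetP => c; rewrite !in_set => /andP[].
rewrite sum_nat_const (card_equation k r) card_configuration.
by rewrite -!mulnA leq_mul2l [leqLHS]mulnC -!mulnA leqnn orbT.
Qed.

Lemma few_bad : (min_field <= #|F|)%N ->
  (2 * #|F| ^ k.+1 * (\sum_c #|[set x | bad c x]|) < #|{: polys}|)%N.
Proof.
move=> F_big; apply: (ltn_union_bound (n := num_copies) _ _ _ sum_bad) => //.
  by apply: leq_trans F_big; rewrite ltnS leq_addl.
by apply/card_gt0P; exists [ffun=> [ffun=> 0]].
Qed.

Lemma sum_common_zero : (0 < r)%N ->
  ((\sum_c #|[set p | common_zero c p]|) * #|F| ^ k.+1 = #|F| ^ #|end_coord| * #|{: polys}|)%N.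
Proof.
move=> r_gt0; rewrite exchange_sum_card big_distrl /= -card_ffun -sum_nat_const.
apply: eq_bigr => p _; pose f (c : polys) : {ffun option 'I_k -> F} := [ffun w => jet (c w) p None].
have fD : {morph f : c c' / c + c'} by move=> c c'; apply/ffunP => w; rewrite !ffunE jetD.
have f_surj y : exists c, f c = y.
  have interpolate w : exists c : coefs, forall (q : unit) o, jet c p o = (fun=> y w) o.
    apply: (@exists_interpolation F _ _ unit (fun=> p) _ (fun _ _ => y w)) => [[] []|] //.
    have : (0 < #|tree_edge|)%N by apply/card_gt0P; exists (inl (None, Ordinal r_gt0)).
    by rewrite card_unit /random_degree ltnS leq_pmul2r // muln_gt0 /num_copies addnS => ->.
  have [c cP] := fin_all_exists interpolate.
  by exists [ffun w => c w]; apply/ffunP => w; rewrite !ffunE (cP w tt).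
have := card_preim_additive [set [ffun=> 0]] fD f_surj.
rewrite card_ffun card_option card_ord cards1 mul1n => <-; congr (_ * _)%N.
apply: eq_card => c; rewrite !inE; apply/forallP/eqP => [c0|/ffunP c0 w].
  by apply/ffunP => w; rewrite !ffunE; apply/eqP.
by have := c0 w; rewrite !ffunE => ->.
Qed.

Lemma exists_good_graph : (0 < r)%N -> (min_field <= #|F|)%N ->
  exists2 c : polys,
    forall l, (max_copies <= l)%N -> ~ blowup_embedding (algebraic_graph c) k r l
    & (#|F| ^ #|end_coord| <= 2 * #|F| ^ k.+1 * #|[set p | common_zero c p]|)%N.
Proof.
move=> r_gt0 F_big; set N := (#|F| ^ #|end_coord|)%N.
have N_gt0 : (0 < N)%N by rewrite expn_gt0 F_gt0.
have [c _ c_good] : exists2 c : polys, true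
    & (N + 2 * #|F| ^ k.+1 * N * #|[set x | bad c x]|
       < 2 * #|F| ^ k.+1 * #|[set p | common_zero c p]|)%N.
  apply: ltn_sum_exists; rewrite big_split /= sum_nat_const -!big_distrr /=.
  have := sum_common_zero r_gt0; have := few_bad F_big; rewrite -/N.
  have mean (C b bads zeros : nat) : (2 * b * bads < C)%N -> (zeros * b = N * C)%N ->
    (C * N + 2 * b * N * bads < 2 * b * zeros)%N by nia.
  exact: mean.
exists c; last by apply: leq_trans (ltnW c_good); apply: leq_addr.
move=> l l_big /blowup_bad[|||x x_bad] //.
  by apply: leq_trans F_big; rewrite leqW // leq_addr.
have bad_gt0 : (0 < #|[set x | bad c x]|)%N by apply/card_gt0P; exists x; rewrite in_set.
have zeros_le : (#|[set p | common_zero c p]| <= N)%N by rewrite /N -card_ffun max_card.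
have := leq_ltn_trans (leq_addl N _) c_good; rewrite ltnNge => /negP[].
exact: leq_trans (leq_mul (leqnn _) zeros_le) (leq_pmulr _ bad_gt0).
Qed.
End RandomGraph.

(** * The extremal function *)

Lemma mem_leaves_Dedge (k r : nat) (v : Dvert k r) : 0 < k -> 0 < r ->
  (v \in leaves (@Dedge k r)) = (if v is inr _ then true else false).
Proof.
move=> k_gt0 r_gt0; rewrite inE; case: v => [u|[u j]]; last first.
  apply/eqP; rewrite -(cards1 (inl u : Dvert k r)); apply: eq_card => -[u'|a];
    by rewrite !inE.
apply/negbTE; rewrite neq_ltn; apply/orP; right.
pose w : Dvert k r := inl (if u is Some _ then None else Some (Ordinal k_gt0)).
pose w' : Dvert k r := inr (u, Ordinal r_gt0).
have w_neq : #|[set w; w']| = 2 by rewrite cards2.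
apply: (@leq_trans #|[set w; w']|); first by rewrite w_neq.
apply: subset_leq_card; apply/subsetP => x; rewrite !inE => /orP[] /eqP ->.
  by rewrite /w; case: (u).
by rewrite /w' /=; case: (u) => // i; apply: eqxx.
Qed.

Section ContainsBlowup.
Variables (n k r l : nat) (g : {ffun 'I_n * 'I_n -> bool}).
Hypotheses (k_gt0 : 0 < k) (r_gt0 : 0 < r) (l_gt0 : 0 < l) (g_simple : simple_graph g).
Notation roots := (leaves (@Dedge k r)).

Lemma inner_vertex_proof (u : option 'I_k) (j : 'I_l) :
  ((inl u : Dvert k r, j).1 \in roots) ==> (val (inl u : Dvert k r, j).2 == 0).
Proof. by rewrite mem_leaves_Dedge. Qed.

Lemma root_vertex_proof (a : option 'I_k * 'I_r) :
  ((inr a : Dvert k r, Ordinal l_gt0).1 \in roots)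
    ==> (val (inr a : Dvert k r, Ordinal l_gt0).2 == 0).
Proof. exact/implyP. Qed.

Definition inner_vertex u j : blowup_vert roots l :=
  Sub (inl u : Dvert k r, j) (inner_vertex_proof u j).
Definition root_vertex a : blowup_vert roots l :=
  Sub (inr a : Dvert k r, Ordinal l_gt0) (root_vertex_proof a).

Lemma contains_blowup_embedding :
  contains (@Dblow k r l) g -> blowup_embedding (graph_rel g) k r l.
Proof.
case/existsP=> f /andP[/injectiveP f_inj /forallP f_hom].
have fP x y : Dblow x y -> graph_rel g (f x) (f y) by have /forallP/(_ y)/implyP := f_hom x.
exists (fun a => f (root_vertex a)), (fun j u => f (inner_vertex u j)).
split=> [a b|j u j' u'|j u a|j u i|j i].
- by move=> /f_inj /(congr1 val) [].
- by move=> /f_inj /(congr1 val) [].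
- by move=> /f_inj /(congr1 val).
- apply: fP; rewrite /Dblow /blowup_edge !SubK /= !mem_leaves_Dedge // !orbT andbT.
  by case: u => // u; apply: eqxx.
- by apply: fP; rewrite /Dblow /blowup_edge !SubK /= eqxx.
Qed.

Lemma blowup_embedding_contains :
  blowup_embedding (graph_rel g) k r l -> contains (@Dblow k r l) g.
Proof.
case=> root [X [root_inj X_inj X_neq_root root_edge inner_edge]].
have [_ g_sym] := simple_graphP _ g_simple.
pose f (x : blowup_vert roots l) : 'I_n :=
  match (val x).1 with inl u => X (val x).2 u | inr a => root a end.
apply/existsP; exists [ffun x => f x]; apply/andP; split.
  apply/injectiveP => -[[[u|a] j] x_ok] [[[u'|a'] j'] y_ok]; rewrite !ffunE /f /= => E.
  - by apply: val_inj => /=; case: (X_inj _ _ _ _ E) => -> ->.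
  - by have := X_neq_root _ _ _ E.
  - by have := X_neq_root _ _ _ (esym E).
  - apply: val_inj => /=; rewrite (root_inj _ _ E); congr (_, _); apply: val_inj.
    by move: (x_ok) (y_ok); rewrite /= !mem_leaves_Dedge //= => /eqP -> /eqP ->.
apply/forallP => -[[[u|[u i]] j] x_ok]; apply/forallP => -[[[u'|[u' i']] j'] y_ok];
  apply/implyP; rewrite /Dblow /blowup_edge !ffunE /f /= ?mem_leaves_Dedge //= ?orbT ?andbT ?orbF
  -/(graph_rel g _ _).
- case: u {x_ok} => [i|]; case: u' {y_ok} => [i'|] //= /eqP <-; last exact: inner_edge.
  by rewrite g_sym; apply: inner_edge.
- by case: u {x_ok} => [w|] /eqP <-; apply: root_edge.
- by rewrite g_sym; case: u' {y_ok} => [w|] /eqP ->; apply: root_edge.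
Qed.
End ContainsBlowup.

Lemma ex_upper (n k r l : nat) : 0 < k -> 0 < r -> 0 < l ->
  ex (@Dblow k r l) n ^ tree_size k r
    <= (4 ^ tree_size k r * upper_const k r l) * n ^ (2 * tree_size k r - k.+1).
Proof.
move=> k_gt0 r_gt0 l_gt0; rewrite /ex; elim/big_ind: _ => [|x y x_le y_le|g /andP[g_simple g_free]].
- by rewrite exp0n // tree_size_gt0.
- by rewrite /maxn; case: ifP.
- apply: nedges_upper => // /(blowup_embedding_contains k_gt0 r_gt0 g_simple).
  exact/negP.
Qed.

Lemma ex_lower (V : finType) (e : rel V) (n k r l : nat) : 0 < k -> 0 < r -> 0 < l ->
  symmetric e -> irreflexive e -> #|V| <= n -> ~ blowup_embedding e k r l ->
  #|[set p : V * V | e p.1 p.2]| <= 2 * ex (@Dblow k r l) n.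
Proof.
move=> k_gt0 r_gt0 l_gt0 e_sym e_irr V_le e_free.
have [->|[[v0 v0'] _]] := set_0Vmem [set p : V * V | e p.1 p.2]; first by rewrite cards0.
pose to_ord (v : V) : 'I_n := widen_ord V_le (enum_rank v).
have to_ord_inj : injective to_ord.
  by move=> v v' /(congr1 val)/= E; apply: enum_rank_inj; apply: val_inj.
pose of_ord (x : 'I_n) : V := odflt v0 [pick v | to_ord v == x].
have to_ordK : cancel to_ord of_ord.
  by move=> v; rewrite /of_ord; case: pickP => [w /eqP/to_ord_inj //|/(_ v)]; rewrite eqxx.
pose g : {ffun 'I_n * 'I_n -> bool} := [ffun p =>
  [&& to_ord (of_ord p.1) == p.1, to_ord (of_ord p.2) == p.2 & e (of_ord p.1) (of_ord p.2)]].
have gE x y : graph_rel g x y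
    = [&& to_ord (of_ord x) == x, to_ord (of_ord y) == y & e (of_ord x) (of_ord y)].
  by rewrite /graph_rel ffunE.
have g_simple : simple_graph g.
  apply/simple_graphP; split=> [x|x y]; first by rewrite gE e_irr !andbF.
  by rewrite !gE e_sym andbCA.
have g_free : ~~ contains (@Dblow k r l) g.
  apply/negP => /(contains_blowup_embedding k_gt0 r_gt0 l_gt0) g_emb; apply: e_free.
  apply: (blowup_embedding_transfer (e := graph_rel g) (h := of_ord)) g_emb => //.
  - by have [] := simple_graphP _ g_simple.
  - by move=> x y; rewrite gE => /and3P[].
  - have fixed x : x \in [pred x | neighbours (graph_rel g) x != set0] -> to_ord (of_ord x) = x.
      by move=> /set0Pn[y]; rewrite inE gE => /andP[/eqP].
    by move=> x y /fixed xE /fixed yE E; rewrite -xE -yE E.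
apply: leq_trans (_ : 2 * nedges g <= _); last first.
  by rewrite leq_mul2l; apply: (@leq_bigmax_cond _ _ (fun g => nedges g)); rewrite g_simple.
rewrite -(sum_neighbours_nedges g_simple) sum_neighbours_card.
have pair_inj : injective (fun p : V * V => (to_ord p.1, to_ord p.2)).
  move=> [a b] [c d] E; have /to_ord_inj/= -> := congr1 fst E.
  by have /to_ord_inj/= -> := congr1 snd E.
rewrite -(card_imset _ pair_inj); apply: subset_leq_card; apply/subsetP => _ /imsetP[[v v'] + ->].
by rewrite !inE gE /= !to_ordK !eqxx.
Qed.

Lemma ex_lower_field (F : finFieldType) (n k r l : nat) : 0 < k -> 0 < r ->
  min_field k r <= #|F| -> max_copies k r <= l -> 2 * #|F| ^ tree_size k r <= n ->
  #|F| ^ (2 * tree_size k r - k.+1) <= 4 * ex (@Dblow k r l) n.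
Proof.
move=> k_gt0 r_gt0 F_big l_big n_big.
have [c c_free c_dense] := exists_good_graph r_gt0 F_big.
have l_gt0 : 0 < l by apply: leq_trans l_big; rewrite /max_copies /num_copies !addnS.
have V_card : #|{: bool * {ffun coord k r -> F}}| <= n.
  by rewrite card_prod card_bool card_ffun card_coord.
have edges_le := ex_lower k_gt0 r_gt0 l_gt0 (@algebraic_graph_sym F k r c)
  (@algebraic_graph_irr F k r c) V_card (c_free l l_big).
have zeros_le := leq_trans (card_common_zero c) edges_le.
have F_gt0 : 0 < #|F| by apply: leq_trans F_big.
have k_le : k.+1 <= 2 * tree_size k r by rewrite /tree_size; lia.
rewrite -(leq_pmul2r (_ : 0 < #|F| ^ k.+1)) ?expn_gt0 ?F_gt0 // -expnD subnK //.
move: c_dense; rewrite card_prod card_bool card_coord => /leq_trans; apply.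
rewrite mulnAC leq_mul2r; apply/orP; right.
by rewrite -[4]/(2 * 2) -mulnA leq_mul2l.
Qed.

Lemma ex_lower_nat (k r : nat) (b := tree_size k r) : 0 < k -> 0 < r ->
  exists N, forall l n, max_copies k r <= l -> N <= n ->
    n ^ (2 * b - k.+1) <= 2 ^ (b.+1 * (2 * b - k.+1)) * 4 ^ b * ex (@Dblow k r l) n ^ b.
Proof.
move=> k_gt0 r_gt0; pose m := min_field k r.
have b_gt0 : 0 < b := tree_size_gt0 r k_gt0.
have base_gt1 : 1 < 2 ^ b by rewrite -[1](expn0 2) ltn_exp2l.
exists (2 * (2 ^ b) ^ m) => l n l_big n_big.
have half_big : (2 ^ b) ^ m <= n %/ 2 by rewrite leq_divRL // mulnC.
have half_gt0 : 0 < n %/ 2 by apply: leq_trans half_big; rewrite !expn_gt0.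
pose j := trunc_log (2 ^ b) (n %/ 2).
have m_le : m <= j by apply: trunc_log_max.
have /andP[half_ge half_lt] := trunc_log_bounds base_gt1 half_gt0; rewrite -/j in half_ge half_lt.
have [F _ F_card] := pPrimePowerField (isT : prime 2) (leq_trans (ltn0Sn _) m_le).
have card_expE : (2 ^ b) ^ j = #|F| ^ b by rewrite F_card -!expnM mulnC.
have F_big : min_field k r <= #|F|.
  by rewrite F_card; apply: leq_trans m_le (ltnW (ltn_expl _ _)).
have n_ge : 2 * #|F| ^ b <= n by rewrite -card_expE mulnC -leq_divRL.
have n_le : n <= 2 ^ b.+1 * #|F| ^ b.
  move: half_lt; rewrite expnS card_expE ltn_divLR // => /ltnW n_le.
  by apply: leq_trans n_le _; rewrite expnS mulnC mulnA.
apply: leq_trans (leq_wexp2r (2 * b - k.+1) n_le) _.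
rewrite expnMn -expnM -mulnA leq_mul2l; apply/orP; right.
rewrite -expnM mulnC expnM -expnMn leq_wexp2r //.
exact: ex_lower_field.
Qed.

(** * Conclusion *)

(* [%R] has meant [ring_scope] since the import of [all_algebra]. *)
Delimit Scope R_scope with R.

Lemma pow_le_reg (x y : R) (b : nat) : 0 < b -> (0 <= y)%R -> (x ^ b <= y ^ b)%R -> (x <= y)%R.
Proof.
move=> b_gt0 y_ge0 pow_le; have [//|yx] := Rle_or_lt x y; exfalso.
have pow_lt m : (y ^ m.+1 < x ^ m.+1)%R.
  elim: m => [|m IH]; first by rewrite !pow_1.
  apply: (Rle_lt_trans _ (y * x ^ m.+1)%R).
    by apply: Rmult_le_compat_l => //; apply: Rlt_le.
  by apply: Rmult_lt_compat_r => //; apply: pow_lt; apply: Rle_lt_trans yx.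
by have := pow_lt b.-1; rewrite prednK // => /Rlt_not_le.
Qed.

Lemma INR_leq (m n : nat) : m <= n -> (INR m <= INR n)%R.
Proof. by move=> /ssrnat.leP; apply: le_INR. Qed.

Lemma INR_gt0 (n : nat) : 0 < n -> (0 < INR n)%R.
Proof. by move=> /ssrnat.ltP; apply: lt_0_INR. Qed.

Lemma INR_expn (m n : nat) : INR (m ^ n) = (INR m ^ n)%R.
Proof. by elim: n => // n IH; rewrite expnS mult_INR IH. Qed.

Lemma Rpower_root (n b t : nat) : 0 < n -> 0 < b -> t <= 2 * b ->
  (Rpower (INR n) (2 - INR t / INR b) ^ b)%R = INR (n ^ (2 * b - t)).
Proof.
move=> n_gt0 b_gt0 t_le; have b_neq0 := Rgt_not_eq _ _ (INR_gt0 b_gt0).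
rewrite -Rpower_pow; last exact: exp_pos.
rewrite Rpower_mult INR_expn -Rpower_pow ?minus_INR ?mult_INR; [|exact/ssrnat.leP|exact: INR_gt0].
by congr Rpower; rewrite Rmult_minus_distr_r /Rdiv Rmult_assoc Rinv_l ?Rmult_1_r.
Qed.

Lemma leq_pow_Rle (x n b t C : nat) : 0 < n -> 0 < b -> 0 < C -> t <= 2 * b ->
  x ^ b <= C * n ^ (2 * b - t) -> (INR x <= INR C * Rpower (INR n) (2 - INR t / INR b))%R.
Proof.
move=> n_gt0 b_gt0 C_gt0 t_le x_le; apply: (pow_le_reg b_gt0).
  by apply: Rmult_le_pos; [apply: pos_INR | apply/Rlt_le/exp_pos].
rewrite Rpow_mult_distr Rpower_root // -!INR_expn -mult_INR; apply: INR_leq.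
by apply: leq_trans x_le _; rewrite leq_mul2r -{1}[C]expn1 leq_pexp2l ?orbT.
Qed.

Lemma leq_pow_Rge (x n b t c : nat) : 0 < n -> 0 < b -> 0 < c -> t <= 2 * b ->
  n ^ (2 * b - t) <= c * x ^ b -> (/ INR c * Rpower (INR n) (2 - INR t / INR b) <= INR x)%R.
Proof.
move=> n_gt0 b_gt0 c_gt0 t_le x_ge; have cR_gt0 := INR_gt0 c_gt0.
apply: (Rmult_le_reg_l (INR c)) => //.
rewrite -Rmult_assoc Rinv_r ?Rmult_1_l; last exact: Rgt_not_eq.
apply: (pow_le_reg b_gt0); first by apply: Rmult_le_pos; apply: pos_INR.
rewrite Rpower_root // Rpow_mult_distr -!INR_expn -mult_INR; apply: INR_leq.
by apply: leq_trans x_ge _; rewrite leq_mul2r -{1}[c]expn1 leq_pexp2l ?orbT.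
Qed.

Theorem theorem3p1 (s t : nat) (hs : (2 <= s)%nat) (ht : (2 <= t)%nat) :
  exists l0 : nat, forall l : nat, (l0 <= l)%nat ->
    exists (c C : R) (N : nat), (0 < c)%R /\ (0 < C)%R /\
      forall n : nat, (N <= n)%nat ->
        let a := (2 - INR t / INR (s * t - 1)%nat)%R in
        (c * Rpower (INR n) a <= INR (ex (@Dblow (t - 1)%nat (s - 1)%nat l) n)
         <= C * Rpower (INR n) a)%R.
Proof.
pose k := t - 1; pose r := s - 1; pose b := tree_size k r.
have [k_gt0 r_gt0] : 0 < k /\ 0 < r by rewrite !subn_gt0.
have tE : t = k.+1 by rewrite /k; lia.
have bE : s * t - 1 = b by rewrite /b /tree_size /k /r; nia.
have [b_gt0 t_le] : 0 < b /\ t <= 2 * b.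
  by rewrite tree_size_gt0 // tE /b /tree_size; split=> //; nia.
exists (max_copies k r) => l l_big.
have l_gt0 : 0 < l by apply: leq_trans l_big; rewrite /max_copies /num_copies !addnS.
have [N lower] := ex_lower_nat k_gt0 r_gt0.
pose C := 4 ^ b * upper_const k r l; pose c := 2 ^ (b.+1 * (2 * b - k.+1)) * 4 ^ b.
have C_gt0 : 0 < C by rewrite muln_gt0 expn_gt0 upper_const_gt0.
have c_gt0 : 0 < c by rewrite muln_gt0 !expn_gt0.
exists (/ INR c)%R, (INR C), N.+1; split; first exact/Rinv_0_lt_compat/INR_gt0.
split; first exact: INR_gt0.
move=> n n_big; have n_gt0 : 0 < n by apply: leq_trans n_big.
rewrite /= bE -/k -/r; split.
- by apply: leq_pow_Rge => //; rewrite tE; apply: lower => //; apply: ltnW.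
- by apply: leq_pow_Rle => //; rewrite tE; apply: ex_upper.
Qed.
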